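(* Let $n\ge1$, let $G$ be a directed monotone $\sigma$-complete po-group with interpolation, and let $E=\Gamma_{ea}(\mathbb Z\,\overrightarrow{\times}\,G,(1,0))$ be the corresponding perfect effect algebra. Then every $n$-dimensional spectral resolution $F:\mathbb R^n\to E$ can be extended to a unique $n$-dimensional observable on $E$, i.e. there is a unique $n$-dimensional observable $x$ on $E$ with $x((-\infty,t_1)\times\cdots\times(-\infty,t_n))=F(t_1,\ldots,t_n)$ for all $(t_1,\ldots,t_n)\in\mathbb R^n$.
   Context: All groups are Abelian and written additively. A po-group $G$ is monotone $\sigma$-complete if every non-decreasing sequence in $G$ bounded above has a supremum in $G$; it has interpolation if whenever $a_1,a_2\le b_1,b_2$ in $G$ there is $c\in G$ with $a_1,a_2\le c\le b_1,b_2$. $\mathbb Z\,\overrightarrow{\times}\,G$ is $\mathbb Z\times G$ with lexicographic order: $(m,g)\le(m',g')$ iff $m<m'$, or $m=m'$ and $g\le g'$. $\Gamma_{ea}(\mathbb Z\,\overrightarrow{\times}\,G,(1,0))$ is the interval effect algebra $[(0,0),(1,0)]$, in which $a+b$ is the group sum, defined when it is $\le(1,0)$; bottom $0=(0,0)$, top $1=(1,0)$. $\mathrm{Rad}(E)=\{(0,g):g\ge 0\}$ and $\mathrm{Rad}(E)'=\{(1,-g): g\ge0\}$; $E$ is their disjoint union. Suprema and infima below are taken in $E$. For $s,t\in\mathbb R^n$, $s\ll t$ (equivalently $t\gg s$) means $s_i<t_i$ for all $i=1,\ldots,n$. For $F:\mathbb R^n\to E$ and reals $a\le b$, $\Delta_i(a,b)F$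 is the function of the remaining variables $F(\ldots,t_{i-1},b,t_{i+1},\ldots)-F(\ldots,t_{i-1},a,t_{i+1},\ldots)$, computed in $\mathbb Z\,\overrightarrow{\times}\,G$. An $n$-dimensional spectral resolution on $E$ is a map $F:\mathbb R^n\to E$ such that: (i) (volume condition) $\Delta_1(a_1,b_1)\cdots\Delta_n(a_n,b_n)F\ge0$ for all reals $a_i\le b_i$, $i=1,\ldots,n$; (ii) $\bigvee_{s\ll t}F(s)=F(t)$ for all $t\in\mathbb R^n$; (iii) $\bigwedge_{t_i\in\mathbb R}F(s_1,\ldots,s_{i-1},t_i,s_{i+1},\ldots,s_n)=0$ for each $i$ and all fixed values of the other variables; (iv) $\bigvee_{s\in\mathbb R^n}F(s)=1$; (v) if $\mathbf t_0=(t^0_1,\ldots,t^0_n)$ denotes the characteristic point of $F$, i.e. the coordinatewise infimum of $T_1=\{t\in\mathbb R^n: F(t)\in\mathrm{Rad}(E)'\}$, then $\bigwedge\{F(s): s\gg\mathbf t_0\}$ exists in $E$ and belongs to $\mathrm{Rad}(E)'$. An $n$-dimensional observable on $E$ is a map $x:\mathcal B(\mathbb R^n)\to E$ on the Borel $\sigma$-algebra such that $x(\mathbb R^n)=1$; $x(A\cup B)=x(A)+x(B)$ (the sum being defined in $E$) for disjoint Borel sets $A,B$; and $x(\bigcup_iA_i)=\bigvee_i x(A_i)$ for every non-decreasing sequence $(A_i)_i$ of Borel sets. *)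

(* Defs.v *)
From HB Require Import structures.
From mathcomp Require Import all_boot all_order all_algebra.
From mathcomp Require Import all_classical all_reals all_analysis.

Set Implicit Arguments.
Unset Strict Implicit.
Unset Printing Implicit Defensive.

Import Order.TTheory GRing.Theory Num.Theory.
Import numFieldNormedType.Exports.

Local Open Scope classical_set_scope.
Local Open Scope ring_scope.

(* [porderZmodType] only joins a partial order with an Abelian group; their
   compatibility is the separate predicate [po_group]. *)
Definition po_group (G : porderZmodType) : Prop :=
  forall a b c : G, a <= b -> a + c <= b + c.

Definition directed_group (G : porderZmodType) : Prop :=
  forall a b : G, exists c : G, a <= c /\ b <= c.

Definition monotone_sigma_complete (G : porderZmodType) : Prop :=
  forall u : nat -> G, {homo u : m k / (m <= k)%N >-> m <= k} ->
    has_ubound (range u) -> supremums (range u) !=set0.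

Definition interpolation (G : porderZmodType) : Prop :=
  forall a1 a2 b1 b2 : G, a1 <= b1 -> a1 <= b2 -> a2 <= b1 -> a2 <= b2 ->
    exists c : G, [/\ a1 <= c, a2 <= c, c <= b1 & c <= b2].

(* Z x G with the componentwise group structure of [int * G] and the
   lexicographic order of [int *lexi G]. *)
Definition lexZ (G : porderZmodType) : Type := (int * G)%type.

HB.instance Definition _ (G : porderZmodType) :=
  GRing.Zmodule.copy (lexZ G) (int * G)%type.
HB.instance Definition _ (G : porderZmodType) :=
  Order.POrder.copy (lexZ G) (int *lexi[ring_display] G).

Definition lexZ_pair (G : porderZmodType) (m : int) (g : G) : lexZ G := (m, g).

Definition lexZ_unit (G : porderZmodType) : lexZ G := lexZ_pair 1 (0 : G).

Record gamma_ea (G : porderZmodType) : Type := GammaEa {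
  ea_val : lexZ G;
  ea_bounds : 0 <= ea_val <= lexZ_unit G }.

HB.instance Definition _ (G : porderZmodType) := [isSub of gamma_ea G for @ea_val G].
HB.instance Definition _ (G : porderZmodType) := [Choice of gamma_ea G by <:].
HB.instance Definition _ (G : porderZmodType) :=
  [SubChoice_isSubPOrder of gamma_ea G by <: with ring_display].

Section PerfectEffectAlgebra.
Variable G : porderZmodType.

Lemma lexZ_unit_ge0 : 0 <= lexZ_unit G.
Proof. by []. Qed.

Lemma ea0_bounds : (0 : lexZ G) <= 0 <= lexZ_unit G.
Proof. by rewrite lexx lexZ_unit_ge0. Qed.

Lemma ea1_bounds : 0 <= lexZ_unit G <= lexZ_unit G.
Proof. by rewrite lexx lexZ_unit_ge0. Qed.

Definition ea0 : gamma_ea G := GammaEa ea0_bounds.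
Definition ea1 : gamma_ea G := GammaEa ea1_bounds.

(* The partial sum: [None] when the sum in Z x G leaves the interval. *)
Definition ea_add (a b : gamma_ea G) : option (gamma_ea G) :=
  insub (ea_val a + ea_val b).

Definition co_rad : set (gamma_ea G) :=
  [set a | exists2 g : G, 0 <= g & ea_val a = lexZ_pair 1 (- g)].

End PerfectEffectAlgebra.

Section SpectralResolutionsAndObservables.
Variables (R : realType) (n : nat) (G : porderZmodType).

Definition strictly_below (s t : 'rV[R]_n) : Prop :=
  forall i, s 0 i < t 0 i.

Definition set_coord (t : 'rV[R]_n) (i : 'I_n) (a : R) : 'rV[R]_n :=
  \row_j (if j == i then a else t 0 j).

(* A function of the variables other than [t 0 i] is represented as a function
   on the whole space that does not depend on [t 0 i]. *)
Definition Delta (i : 'I_n) (a b : R) (H : 'rV[R]_n -> lexZ G) :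
    'rV[R]_n -> lexZ G :=
  fun t => H (set_coord t i b) - H (set_coord t i a).

Definition iter_Delta (a b : 'rV[R]_n) (H : 'rV[R]_n -> lexZ G) :
    'rV[R]_n -> lexZ G :=
  foldr (fun i K => Delta i (a 0 i) (b 0 i) K) H (enum 'I_n).

Definition volume_condition (F : 'rV[R]_n -> gamma_ea G) : Prop :=
  forall a b : 'rV[R]_n, (forall i, a 0 i <= b 0 i) ->
    forall t, 0 <= iter_Delta a b (@ea_val G \o F) t.

(* [inf] has a junk value on sets that are empty or not bounded below, but
   the other conditions of [spectral_resolution] make every coordinate
   projection of [set t | co_rad (F t)] nonempty and bounded below. *)
Definition characteristic_point (F : 'rV[R]_n -> gamma_ea G) : 'rV[R]_n :=
  \row_i inf [set t 0 i | t in [set t | co_rad (F t)]].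

Record spectral_resolution (F : 'rV[R]_n -> gamma_ea G) : Prop := {
  sr_volume : volume_condition F;
  sr_left_continuous : forall t,
    supremums [set F s | s in [set s | strictly_below s t]] (F t);
  sr_bottom : forall (i : 'I_n) (s : 'rV[R]_n),
    infimums (range (fun a : R => F (set_coord s i a))) (ea0 G);
  sr_top : supremums (range F) (ea1 G);
  sr_characteristic : exists2 m : gamma_ea G,
    infimums
      [set F s | s in [set s | strictly_below (characteristic_point F) s]] m &
    co_rad m }.

Definition borel_Rn : set (set 'rV[R]_n) := <<s @open 'rV[R]_n >>.

(* An observable is a total function on sets, of which only the values on
   Borel sets matter. *)
Record observable (x : set 'rV[R]_n -> gamma_ea G) : Prop := {
  obs_total : x setT = ea1 G;
  obs_additive : forall A B, borel_Rn A -> borel_Rn B -> A `&` B = set0 ->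
    ea_add (x A) (x B) = Some (x (A `|` B));
  obs_continuous : forall A : nat -> set 'rV[R]_n,
    (forall k, borel_Rn (A k)) -> (forall k, A k `<=` A k.+1) ->
    supremums (range (fun k => x (A k))) (x (\bigcup_k A k)) }.

Definition lower_orthant (t : 'rV[R]_n) : set 'rV[R]_n :=
  [set s | strictly_below s t].

Definition extends_resolution (F : 'rV[R]_n -> gamma_ea G)
    (x : set 'rV[R]_n -> gamma_ea G) : Prop :=
  forall t, x (lower_orthant t) = F t.

End SpectralResolutionsAndObservables.

(* Main.v *)
Require Import Defs.
From mathcomp Require Import all_boot all_order all_algebra.
From mathcomp Require Import all_classical all_reals all_analysis.
From mathcomp Require Import lra zify.

Set Implicit Arguments.
Unset Strict Implicit.
Unset Printing Implicit Defensive.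

Import Order.TTheory GRing.Theory Num.Theory.
Import numFieldNormedType.Exports.

Local Open Scope classical_set_scope.
Local Open Scope ring_scope.

(** A monotone sigma-complete group [G] with interpolation is integrally closed, and
    integral closedness alone makes the following substitute for a Loomis-Sikorski
    representation work. Nonzero bands of the Dedekind completion of [G] are replaced
    by lower sets of [G] that contain an element [y] with [~ y <= 0]; ordered by
    inclusion they form a notion of forcing, and a sufficiently generic descending
    sequence of them assigns to every element of [[0, u]] a real number in [[0, 1]].
    Outside of a negligible set of sequences this assignment is additive, monotone and
    continuous along a given increasing sequence, and an inequality that holds for
    generic sequences holds in [G]. So a finitely additive [G]-valued mass on the
    cylinders of the Cantor space becomes, generically, a real mass, which extends to a
    Borel measure as an image of Lebesgue measure; by the pi-lambda theorem, every
    Borel set then has a value in [G] that represents its measure generically.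

    A distribution function on [R^n] is transported to the Cantor space by coding a
    point by the truth values of [x_i < q], for [i] a coordinate and [q] a rational. A
    spectral resolution is reduced to a distribution function by moving the mass
    [(1, - u)] of the characteristic point to [0]: its level is the Dirac measure at
    that point, and everywhere else the values are in the positive cone of [G]. *)

(** * Partially ordered groups *)

(** [G] need not be a lattice, and no distributive law between countable suprema and infima is
    assumed, so outer measures and arguments with small errors cannot be carried out in [G] itself.
    Along one generic sequence the errors are real numbers. Each generic property brings its own
    countable list of dense requirements, so no single sequence has to serve all Borel sets at once.
    The Cantor space is used because additivity on a binary tree is all that a real mass needs in
    order to extend. The behaviour of a distribution function at infinity enters only afterwards, to
    show that codes of no point are null, and left continuity only to evaluate orthants. The atom
    has to be removed because Z x G is not integrally closed once [G] is nonzero: all multiples of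
    an infinitesimal (0, g) lie below (1, 0). What remains of the total (1, 0) after removing (1, -
    u) is (0, u), so the same [u] is the total mass in [G] and the unit in which real values are
    measured. *)

Definition is_lub (G : porderZmodType) (u : nat -> G) (s : G) : Prop :=
  (forall k, u k <= s) /\ (forall y, (forall k, u k <= y) -> s <= y).

Definition nondec (G : porderZmodType) (u : nat -> G) : Prop :=
  forall m k, (m <= k)%N -> u m <= u k.

Definition integrally_closed (G : porderZmodType) : Prop :=
  forall a b : G, (forall k, a *+ k <= b) -> a <= 0.

Section PoGroup.
Variables (G : porderZmodType) (po : po_group G).
Implicit Types a b c d x y : G.

Lemma po_leDr c a b : (a + c <= b + c) = (a <= b).
Proof.
apply/idP/idP => [h|]; last exact: po.
by rewrite -(addrK c a) -(addrK c b); apply: po.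
Qed.

Lemma po_leDl c a b : (c + a <= c + b) = (a <= b).
Proof. by rewrite ![c + _]addrC po_leDr. Qed.

Lemma po_leD a b c d : a <= b -> c <= d -> a + c <= b + d.
Proof. by move=> ab cd; apply: (@le_trans _ _ (b + c)); rewrite ?po_leDr ?po_leDl. Qed.

Lemma po_leBlDr a b c : (a - b <= c) = (a <= c + b).
Proof. by rewrite -(po_leDr b (a - b)) subrK. Qed.

Lemma po_leBrDr a b c : (a <= b - c) = (a + c <= b).
Proof. by rewrite -(po_leDr c a (b - c)) subrK. Qed.

Lemma po_subge0 a b : (0 <= b - a) = (a <= b).
Proof. by rewrite po_leBrDr add0r. Qed.

Lemma po_suble0 a b : (b - a <= 0) = (b <= a).
Proof. by rewrite po_leBlDr add0r. Qed.

Lemma po_leN a b : (- a <= - b) = (b <= a).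
Proof. by rewrite -(po_subge0 (- a)) opprK addrC po_subge0. Qed.

Lemma po_oppr_le0 a : (- a <= 0) = (0 <= a).
Proof. by rewrite -(po_leDr a _ 0) addNr add0r. Qed.

Lemma po_oppr_ge0 a : (0 <= - a) = (a <= 0).
Proof. by rewrite -(po_leDr a 0) addNr add0r. Qed.

Lemma po_leN2 a b : (a <= - b) = (b <= - a).
Proof. by rewrite -(po_leN (- b)) opprK. Qed.

Lemma po_leNl a b : (- a <= b) = (- b <= a).
Proof. by rewrite -(po_leN b (- a)) opprK. Qed.

Lemma po_addr_ge0 a b : 0 <= a -> 0 <= b -> 0 <= a + b.
Proof. by move=> ha hb; rewrite -(addr0 0); exact: po_leD. Qed.

Lemma po_lerDl a b : (a <= a + b) = (0 <= b).
Proof. by rewrite -{1}(addr0 a) po_leDl. Qed.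

Lemma po_lerDr a b : (a <= b + a) = (0 <= b).
Proof. by rewrite addrC po_lerDl. Qed.

Lemma po_lerBl a b : (a - b <= a) = (0 <= b).
Proof. by rewrite po_leBlDr po_lerDl. Qed.

Lemma po_leMn k a b : a <= b -> a *+ k <= b *+ k.
Proof. by move=> ab; elim: k => // k IH; rewrite !mulrS; exact: po_leD. Qed.

Lemma po_Mn_ge0 k a : 0 <= a -> 0 <= a *+ k.
Proof. by move=> /(po_leMn k); rewrite mul0rn. Qed.

Lemma po_leMnr a m k : 0 <= a -> (m <= k)%N -> a *+ m <= a *+ k.
Proof. by move=> a0 mk; rewrite -(subnKC mk) mulrnDr po_lerDl; exact: po_Mn_ge0. Qed.

Lemma po_sum_ge0 (I : Type) (r : seq I) (P : pred I) (F : I -> G) :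
  (forall i, P i -> 0 <= F i) -> 0 <= \sum_(i <- r | P i) F i.
Proof. by move=> h; elim/big_ind : _ => //; exact: po_addr_ge0. Qed.

Lemma po_le_sum (I : Type) (r : seq I) (F1 F2 : I -> G) :
  (forall i, F1 i <= F2 i) -> \sum_(i <- r) F1 i <= \sum_(i <- r) F2 i.
Proof. by move=> h; elim/big_ind2 : _ => // *; exact: po_leD. Qed.

Lemma nondec_step (u : nat -> G) : (forall k, u k <= u k.+1) -> nondec u.
Proof.
move=> h m k mk; rewrite -(subnKC mk); elim: (k - m)%N => [|j IH]; first by rewrite addn0.
by rewrite addnS; exact: le_trans IH (h _).
Qed.

Lemma is_lub_unique (u : nat -> G) s t : is_lub u s -> is_lub u t -> s = t.
Proof.
by move=> [us su] [ut tu]; apply/le_anti/andP; split; [exact: su|exact: tu].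
Qed.

Lemma is_lubP (u : nat -> G) s : is_lub u s <-> supremums (range u) s.
Proof.
split=> -[us su].
  split=> [_ [k _ <-]|y yu]; first exact: us.
  by apply: su => k; apply: yu; exists k.
split=> [k|y yu]; first by apply: us; exists k.
by apply: su => _ [k _ <-].
Qed.

Lemma is_lubD (u v : nat -> G) s t : nondec u -> nondec v ->
  is_lub u s -> is_lub v t -> is_lub (fun k => u k + v k) (s + t).
Proof.
move=> ndu ndv [us su] [vt tv]; split=> [k|y uvy]; first exact: po_leD.
rewrite addrC -po_leBrDr; apply: tv => k; rewrite po_leBrDr addrC -po_leBrDr.
apply: su => j; rewrite po_leBrDr; apply: le_trans (uvy (maxn j k)).
by apply: po_leD; [apply: ndu|apply: ndv]; rewrite ?leq_maxl ?leq_maxr.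
Qed.

Lemma is_lub_addr (u : nat -> G) s c : is_lub u s -> is_lub (fun k => u k + c) (s + c).
Proof.
move=> [us su]; split=> [k|y uy]; first by rewrite po_leDr.
by rewrite -po_leBrDr; apply: su => k; rewrite po_leBrDr.
Qed.

Lemma is_lub_eventually (u v : nat -> G) s m : nondec u -> nondec v ->
  (forall k, (m <= k)%N -> u k = v k) -> is_lub u s -> is_lub v s.
Proof.
move=> ndu ndv uv [us su]; split=> [k|y vy].
  apply: (le_trans (ndv _ _ (leq_maxr m k))).
  by rewrite -uv ?leq_maxl.
apply: su => k; apply: (le_trans (ndu _ _ (leq_maxr m k))).
by rewrite uv ?leq_maxl.
Qed.

Lemma is_lub_const c : is_lub (fun=> c) c.
Proof. by split=> // y /(_ 0%N). Qed.

Section Complete.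
Hypothesis sc : monotone_sigma_complete G.

Lemma nondec_lub (u : nat -> G) b : nondec u -> (forall k, u k <= b) ->
  exists s, is_lub u s.
Proof.
move=> nd ub; have [|s /is_lubP us] := sc nd; last by exists s.
by exists b => _ [k _ <-]; exact: ub.
Qed.

Lemma noninc_glb (u : nat -> G) b : (forall k, u k.+1 <= u k) -> (forall k, b <= u k) ->
  exists s, (forall k, s <= u k) /\ (forall y, (forall k, y <= u k) -> y <= s).
Proof.
move=> nd bu; have [||s [us su]] := @nondec_lub (fun k => - u k) (- b).
- by apply: nondec_step => k; rewrite po_leN.
- by move=> k; rewrite po_leN; exact: bu.
exists (- s); split=> [k|y yu].
  by rewrite -po_leN opprK.
by rewrite po_leN2; apply: su => k; rewrite po_leN; exact: yu.
Qed.

Hypothesis itp : interpolation G.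

(** Interpolating between [x], [y] on one side and the previous interpolant and the next bound on
    the other gives a decreasing sequence; its infimum stays above [x] and [y]. *)
Lemma interpolation_sequence (x y : G) (b : nat -> G) :
  (forall k, x <= b k) -> (forall k, y <= b k) ->
  exists c, [/\ x <= c, y <= c & forall k, c <= b k].
Proof.
move=> xb yb.
pose f b1 b2 := xget 0 [set c | [/\ x <= c, y <= c, c <= b1 & c <= b2]].
have fP b1 b2 : x <= b1 -> x <= b2 -> y <= b1 -> y <= b2 ->
    [/\ x <= f b1 b2, y <= f b1 b2, f b1 b2 <= b1 & f b1 b2 <= b2].
  by move=> h1 h2 h3 h4; apply: (@xgetPex _ 0 [set c | [/\ x <= c, y <= c, c <= b1 & c <= b2]]); exact: itp.
pose d := fix d k := if k is j.+1 then f (d j) (b j.+1) else b 0%N.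
have dP k : x <= d k /\ y <= d k.
  elim: k => [|k [IHx IHy]] /=; first by rewrite xb yb.
  by have [] := fP (d k) (b k.+1).
have dS k : d k.+1 <= d k /\ d k.+1 <= b k.+1.
  by have [hx hy] := dP k; have [] := fP (d k) (b k.+1).
have [||c [cd dc]] := @noninc_glb d x; [by move=> k; case: (dS k)|by move=> k; case: (dP k)|].
exists c; split; [by apply: dc => k; case: (dP k)|by apply: dc => k; case: (dP k)|].
by case=> [|k]; [exact: (cd 0%N)|apply: le_trans (cd k.+1) _; case: (dS k)].
Qed.

Lemma countable_interpolation (a b : nat -> G) : (forall i j, a i <= b j) ->
  exists c, forall k, a k <= c <= b k.
Proof.
move=> ab.
pose f x y := xget 0 [set c | [/\ x <= c, y <= c & forall k, c <= b k]].
have fP x y : (forall k, x <= b k) -> (forall k, y <= b k) ->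
    [/\ x <= f x y, y <= f x y & forall k, f x y <= b k].
  move=> h1 h2; apply: (@xgetPex _ 0 [set c | [/\ x <= c, y <= c & forall k, c <= b k]]).
  exact: interpolation_sequence.
pose d := fix d k := if k is j.+1 then f (d j) (a j.+1) else a 0%N.
have dP k j : d k <= b j.
  elim: k j => [//|k IH] j /=; first exact: ab.
  by have [] := fP (d k) (a k.+1).
have dS k : d k <= d k.+1 /\ a k.+1 <= d k.+1.
  by have [] := fP (d k) (a k.+1) (dP k) (ab _).
have [||c [dc cd]] := @nondec_lub d (b 0%N).
- by apply: nondec_step => k; case: (dS k).
- by move=> k.
exists c => k; rewrite cd ?andbT//; case: k => [|k]; first exact: (dc 0%N).
by apply: le_trans (dc k.+1); case: (dS k).
Qed.

(** An upper bound of all multiples of [a] can be halved and remain one; iteration gives bounds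
    [d k] with [d k *+ 2 ^ k <= b]. Their infimum [x] is nonnegative with all multiples below [b],
    and translating the supremum of these multiples by [x] shows [x <= 0]. *)
Lemma sigma_complete_integrally_closed : integrally_closed G.
Proof.
move=> a b ab.
pose H x := forall k, a *+ k <= x.
have halve x : H x -> exists d, H d /\ d + d <= x.
  move=> Hx.
  have [|c cP] := @countable_interpolation (fun k => a *+ k) (fun k => x - a *+ k).
    by move=> i j; rewrite po_leBrDr -mulrnDr.
  (* Both [c] and [x - c] dominate the multiples of [a], so an interpolant below the two satisfies
     [d + d <= x]. The parity only lists two bounds as a sequence. *)
  have [|d dP] := @countable_interpolation (fun k => a *+ k)
      (fun k => if odd k then c else x - c).
    move=> i j; have /andP[h1 h2] := cP i; case: (odd j) => //.
    by rewrite po_leBrDr addrC -po_leBrDr.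
  exists d; split; first by move=> k; case/andP: (dP k).
  have /andP[_ h1] := dP 1%N; have /andP[_ h0] := dP 0%N.
  by move: h0 => /=; rewrite po_leBrDr; apply: le_trans; rewrite po_leDl.
pose f x := xget 0 [set d | H d /\ d + d <= x].
have fP x : H x -> H (f x) /\ f x + f x <= x.
  by move=> /halve h; apply: (@xgetPex _ 0 [set d | H d /\ d + d <= x]).
pose d k := iter k f b.
have dP k : H (d k) by elim: k => [//|k IH]; exact: (fP _ IH).1.
have d0 k : 0 <= d k by exact: (dP k 0%N).
have dS k : d k.+1 + d k.+1 <= d k by exact: (fP _ (dP k)).2.
have d2 k : d k *+ (2 ^ k)%N <= b.
  elim: k => [|k IH]; first by rewrite expn0 mulr1n.
  apply: le_trans IH; rewrite expnS mulrnA mulr2n; exact: po_leMn.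
have [|x [xd dx]] := @noninc_glb d 0 _ d0.
  by move=> k; apply: le_trans (dS k); rewrite po_lerDl.
have x0 : 0 <= x by apply: dx.
have [||s [us su]] := @nondec_lub (fun k => x *+ k) b.
- by move=> m k; exact: po_leMnr.
- move=> k; apply: le_trans (d2 k); apply: le_trans (po_leMn _ (xd k)) _.
  by apply: po_leMnr => //; exact/ltnW/ltn_expl.
suff : x <= 0.
  by apply: le_trans; apply: dx => k; exact: (dP k 1%N).
rewrite -(po_leDl s) addr0 -po_leBrDr; apply: su => k.
by rewrite po_leBrDr -mulrSr.
Qed.

End Complete.

End PoGroup.

(** * Real values of group elements at generic conditions *)

Section Forcing.
Variables (G : porderZmodType) (po : po_group G).
Hypotheses (dir : directed_group G) (ic : integrally_closed G).
Implicit Types (L : set G) (x y : G).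

(** All multiples of [y] lie below a common upper bound of [0] and [y]: even multiples are at most
    [0], and odd ones add one copy of [y]. *)
Lemma double_le0 y : y + y <= 0 -> y <= 0.
Proof.
move=> yy; have [b [b0 yb]] := dir 0 y; apply: (ic (b := b)) => k.
rewrite -(odd_double_half k) mulrnDr -muln2 mulnC mulrnA mulr2n.
rewrite -[leRHS]addr0; apply: (po_leD po); first by case: (odd k); rewrite ?mulr1n.
by rewrite -(mul0rn _ k./2); exact: po_leMn.
Qed.

Definition lower_closed L : Prop := forall x y, L x -> y <= x -> L y.

(* In the Dedekind completion: the negative part of [x] is disjoint from the positive
   parts of the elements of [L]. *)
Definition forces L x : Prop := forall y, L y -> y <= - x -> y <= 0.

Lemma forces_sub L L' x : L' `<=` L -> forces L x -> forces L' x.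
Proof. by move=> LL' h y /LL'; exact: h. Qed.

Lemma forces_ge0 L x : 0 <= x -> forces L x.
Proof. by move=> x0 y _ /le_trans; apply; rewrite po_oppr_le0. Qed.

(* The common upper bounds of [0] and [a := - x'] are stable under subtracting [y],
   so the multiples of [y] are bounded above. *)
Lemma forcesD L x x' : lower_closed L -> forces L x -> forces L x' -> forces L (x + x').
Proof.
move=> Ll hx hx' y Ly; rewrite opprD => yxx.
set a := - x'.
have stepA v : 0 <= v -> a <= v -> y <= v.
  move=> v0 av; rewrite -(po_suble0 po); apply: hx.
    by apply: (Ll y) => //; rewrite po_lerBl.
  apply: (@le_trans _ _ (y - a)); first by rewrite po_leDl// po_leN.
  by rewrite (po_leBlDr po).
have stepB v : 0 <= v -> a <= v -> a <= v - y.
  move=> v0 av; rewrite (po_leBrDr po) addrC -(po_suble0 po).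
  have yv := stepA _ v0 av.
  apply: hx'.
    by apply: (Ll y) => //; rewrite (po_leBlDr po) (po_leDl po).
  by rewrite -/a (po_leBlDr po) addrC (po_leDl po).
have stepC v k : 0 <= v -> a <= v -> 0 <= v - y *+ k /\ a <= v - y *+ k.
  move=> v0 av; elim: k => [|k [IH0 IHa]]; first by rewrite mulr0n subr0.
  rewrite mulrSr opprD addrA; split; last exact: stepB.
  by rewrite (po_subge0 po); exact: stepA.
have [v [v0 av]] := dir 0 a.
by apply: (ic (b := v)) => k; rewrite -(po_subge0 po); case: (stepC v k).
Qed.

Lemma forcesMn L x k : lower_closed L -> forces L x -> forces L (x *+ k).
Proof.
move=> Ll hx; elim: k => [|k IH]; first by rewrite mulr0n; exact: forces_ge0.
by rewrite mulrS; exact: forcesD.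
Qed.

Lemma forces_below L x : forces (L `&` [set y | y <= x]) x.
Proof.
move=> y [_ /= yx] yNx; apply: double_le0.
by rewrite -(subrr x); exact: (po_leD po).
Qed.

Variable u : G.
Hypothesis u0 : 0 <= u.

(** The bound by [u] makes [u] a unit at every condition: none forces a negative multiple of it. The
    last clause says that the band represented by [L] is nonzero. *)
Definition condition L : Prop :=
  [/\ lower_closed L, forall y, L y -> y <= u & exists2 y, L y & ~ y <= 0].

Lemma condition_lower L : condition L -> lower_closed L. Proof. by case. Qed.

Lemma condition_below L x y : condition L -> L y -> y <= x -> ~ y <= 0 ->
  condition (L `&` [set y | y <= x]).
Proof.
move=> [Ll Lu _] Ly yx y0; split; last by exists y.
- by move=> a b [La /= ax] ba; split; [exact: Ll ba|exact: le_trans ax].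
- by move=> z [/Lu].
Qed.

Lemma condition_consistent L k : condition L -> forces L (- (u *+ k)) -> k = 0%N.
Proof.
case=> _ Lu [y Ly y0] h; apply/eqP; rewrite -leqn0 leqNgt; apply/negP => k0.
apply: y0; apply: h => //; rewrite opprK (le_trans (Lu _ Ly))//.
by rewrite -[leLHS]mulr1n; exact: po_leMnr.
Qed.

(** Either [L] can be cut below [x], or no element of [L] below [x] escapes being [<= 0], which is
    what it means to force [- x]. *)
Lemma condition_decides L x : condition L ->
  exists L', [/\ L' `<=` L, condition L' & forces L' x \/ forces L' (- x)].
Proof.
move=> cL; have [[y [Ly yx y0]]|h] := pselect (exists y, [/\ L y, y <= x & ~ y <= 0]).
  exists (L `&` [set y | y <= x]); split; first exact: subIsetl.
  - exact: condition_below Ly yx y0.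
  - by left; exact: forces_below.
exists L; split=> //; right=> y Ly; rewrite opprK => yx.
by apply: contrapT => y0; apply: h; exists y.
Qed.

(** Otherwise every [y] in [L] satisfies [y <= (s - g k) *+ m] for all [k]; since [s - g k]
    decreases to [0], so do its multiples, and [L] would have no element outside the negative
    cone. *)
Lemma condition_lub L (g : nat -> G) s m : nondec g -> is_lub g s -> condition L ->
  exists k L', [/\ L' `<=` L, condition L' & forces L' (u - (s - g k) *+ m)].
Proof.
move=> ndg [gs sg] cL.
have [[k [y [Ly yx y0]]]|h] := pselect (exists k y,
    [/\ L y, y <= u - (s - g k) *+ m & ~ y <= 0]).
  exists k, (L `&` [set y | y <= u - (s - g k) *+ m]).
  by split; [exact: subIsetl|exact: condition_below Ly yx y0|exact: forces_below].
have d0 k : 0 <= s - g k by rewrite (po_subge0 po).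
(* Comparison at [maxn k i] detaches one copy of [s - g i] from the other [j] copies of
   [s - g k]. *)
have key j y : (forall k, y <= (s - g k) *+ j) -> y <= 0.
  elim: j y => [|j IH] y hy; first exact: (hy 0%N).
  have le_d i : y <= s - g i.
    rewrite -(po_suble0 po); apply: IH => k.
    rewrite (po_leBlDr po); apply: (le_trans (hy (maxn k i))).
    rewrite mulrSr; apply: (po_leD po); first apply: (po_leMn po).
    - by rewrite (po_leDl po) (po_leN po); apply: ndg; rewrite leq_maxl.
    - by rewrite (po_leDl po) (po_leN po); apply: ndg; rewrite leq_maxr.
  rewrite -(po_oppr_ge0 po) -(po_leDl po s) addr0; apply: sg => k.
  by rewrite (po_leBrDr po) addrC -(po_leBrDr po).
have [Ll Lu [y Ly y0]] := cL; exfalso; apply: y0.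
apply: (key m) => k; rewrite -(po_suble0 po); apply: contrapT => yd.
apply: h; exists k, (y - (s - g k) *+ m); split=> //.
- by apply: (Ll y) => //; rewrite po_lerBl// po_Mn_ge0.
- by rewrite (po_leDr po); exact: Lu.
Qed.

(** The conclusion says that [- x] exceeds [u / m] on a nonzero band. Some [y], not [<= 0], lies
    below both [- x] and [u]; by integral closedness its multiples cannot all stay below [u], and
    the condition is found where [y *+ m] exceeds [u]. *)
Lemma condition_negative x K : - x <= u *+ K -> ~ 0 <= x ->
  exists L m, condition L /\ forces L (- (x *+ m) - u).
Proof.
move=> xK x0; apply: contrapT => noL.
have low y : lower_closed [set z | z <= y] by move=> a b /= ay ba; exact: le_trans ay.
have [[y [yx yu y0]]|h] := pselect (exists y, [/\ y <= - x, y <= u & ~ y <= 0]); last first.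
  apply: x0; rewrite -(po_oppr_le0 po).
  (* Without such a [y], the lower set of [- x] forces [- u], hence [- (u *+ K)]; its own element
     [- x] is below [u *+ K], so it would be [<= 0]. *)
  have /(forcesMn (k := K)) : forces [set z | z <= - x] (- u).
    move=> z /= zx; rewrite opprK => zu; apply: contrapT => z0.
    by apply: h; exists z.
  by move=> /(_ (low _)); apply=> //=; rewrite mulNrn opprK.
apply: y0; apply: (ic (b := u)) => m; rewrite -(po_suble0 po).
have : forces [set z | z <= y *+ m - u] (u - y *+ m).
  apply: forcesD (low _) _ _; first exact: forces_ge0.
  rewrite -mulNrn; apply: forcesMn (low _) _ => z /= zm; rewrite opprK => zy.
  apply: contrapT => z0; apply: noL.
  exists ([set z | z <= y] `&` [set z | z <= - (x *+ m) - u]), m.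
  split; last exact: forces_below.
  split.
  - by move=> a b [/= ay ax] ba; split => /=; exact: le_trans ba _.
  - by move=> a [/= ay _]; exact: le_trans yu.
  - exists z => //; split=> //=; apply: (le_trans zm).
    by rewrite (po_leDr po) -mulNrn; exact: po_leMn.
by apply=> //=; rewrite opprB.
Qed.

(** * Generic descending sequences of conditions *)

Definition descending (w : nat -> set G) : Prop :=
  (forall k, condition (w k)) /\ (forall k, w k.+1 `<=` w k).

Lemma descending_sub w j k : descending w -> (j <= k)%N -> w k `<=` w j.
Proof.
move=> [_ ws] jk; rewrite -(subnKC jk); elim: (k - j)%N => [|i IH]; first by rewrite addn0.
by rewrite addnS; exact: subset_trans (ws _) IH.
Qed.

Definition dense_conditions (D : set (set G)) : Prop :=
  forall L, condition L -> exists L', [/\ L' `<=` L, condition L' & D L'].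

(** The analogue of holding on a comeager set. The dense sets may depend on the property, so
    countably many generic properties hold together. *)
Definition generically (Q : (nat -> set G) -> Prop) : Prop :=
  exists D : nat -> set (set G), (forall j, dense_conditions (D j)) /\
    forall w, descending w -> (forall j, exists k, D j (w k)) -> Q w.

Lemma generically_imp (Q Q' : (nat -> set G) -> Prop) :
  (forall w, descending w -> Q w -> Q' w) -> generically Q -> generically Q'.
Proof.
by move=> QQ' [D [dD DQ]]; exists D; split=> // w dw hw; apply: QQ' => //; exact: DQ.
Qed.

Lemma dense_setT : dense_conditions setT.
Proof. by move=> L cL; exists L; split. Qed.

Lemma generically_forall (T : countType) (Q : T -> (nat -> set G) -> Prop) :
  (forall t, generically (Q t)) -> generically (fun w => forall t, Q t w).
Proof.
move=> /choice[D DP].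
exists (fun n => if (unpickle n : option (T * nat)) is Some (t, j) then D t j else setT).
split=> [n|w dw hw t].
  case: (unpickle n) => [[t j]|]; [exact: (DP t).1|exact: dense_setT].
apply: (DP t).2 => // j; have [k] := hw (pickle (t, j)).
by rewrite pickleK => Dk; exists k.
Qed.

Lemma generically_and Q Q' : generically Q -> generically Q' ->
  generically (fun w => Q w /\ Q' w).
Proof.
move=> h h'; have /generically_forall : forall b : bool, generically (if b then Q else Q') by case.
by apply: generically_imp => w _ hw; split; [exact: (hw true)|exact: (hw false)].
Qed.

Lemma generically_dense D : dense_conditions D -> generically (fun w => exists k, D (w k)).
Proof. by move=> dD; exists (fun=> D); split=> // w _ /(_ 0%N). Qed.

Lemma generically_true (Q : (nat -> set G) -> Prop) :
  (forall w, descending w -> Q w) -> generically Q.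
Proof. by move=> h; exists (fun=> setT); split=> [_|w dw _]; [exact: dense_setT|exact: h]. Qed.

(* The Rasiowa-Sikorski lemma. *)
Lemma generically_exists Q L : generically Q -> condition L ->
  exists w, [/\ descending w, w 0%N = L & Q w].
Proof.
move=> [D [dD DQ]] cL.
have /choice[f fP] (jL : nat * set G) : exists L', condition jL.2 ->
    [/\ L' `<=` jL.2, condition L' & D jL.1 L'].
  case: (pselect (condition jL.2)) => [/(dD jL.1)[L' h]|h]; first by exists L'.
  by exists set0 => /h.
pose w := fix w k := if k is j.+1 then f (j, w j) else L.
have cw k : condition (w k) by elim: k => [//|k /(fP (k, w k))[]].
have dw : descending w by split=> // k; case: (fP (k, w k) (cw k)).
exists w; split=> //; apply: DQ => // j; exists j.+1.
by case: (fP (j, w j) (cw j)).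
Qed.

Section Values.
Variable R : realType.

(** The value of a state normalized at [u], as in Hoelder's embedding of Archimedean groups: a
    fraction counts when some condition of the sequence forces the corresponding comparison with
    [u]. The successor avoids a zero denominator. *)
Definition value (w : nat -> set G) (g : G) : R :=
  sup [set r | exists p m, r = p%:R / m.+1%:R /\ exists k, forces (w k) (g *+ m.+1 - u *+ p)].

Definition decides (w : nat -> set G) (g : G) : Prop :=
  forall p m, exists k, forces (w k) (g *+ m - u *+ p) \/ forces (w k) (u *+ p - g *+ m).

Lemma generically_decides g : generically (decides^~ g).
Proof.
have : forall pm : nat * nat, generically (fun w => exists k,
    forces (w k) (g *+ pm.2 - u *+ pm.1) \/ forces (w k) (u *+ pm.1 - g *+ pm.2)).
  move=> [p m]; apply: (@generically_dense
    [set L | forces L (g *+ m - u *+ p) \/ forces L (u *+ p - g *+ m)]) => L cL /=.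
  have [L' [L'L cL' h]] := condition_decides (g *+ m - u *+ p) cL.
  by exists L'; split=> //=; rewrite opprB in h.
move=> /generically_forall; apply: generically_imp => w _ h p m; exact: (h (p, m)).
Qed.

(** Cross multiplication: if the inequality failed, adding suitable multiples of the two forced
    relations would force a negative multiple of [u] at a common later condition. *)
Lemma forces_consistent w g j k p m p' m' : descending w ->
  forces (w j) (g *+ m - u *+ p) -> forces (w k) (u *+ p' - g *+ m') ->
  (p * m' <= p' * m)%N.
Proof.
move=> dw h h'; set l := maxn j k.
have low := condition_lower (dw.1 l).
have /(forcesMn (k := m') low) hl : forces (w l) (g *+ m - u *+ p).
  by apply: forces_sub h; apply: descending_sub => //; rewrite leq_maxl.
have /(forcesMn (k := m) low) hl' : forces (w l) (u *+ p' - g *+ m').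
  by apply: forces_sub h'; apply: descending_sub => //; rewrite leq_maxr.
have hu := forcesD low hl hl'.
rewrite leqNgt; apply/negP => lt.
suff /eqP : (p * m' - p' * m)%N = 0%N by rewrite subn_eq0 leqNgt lt.
apply: (condition_consistent (dw.1 l)); move: hu.
rewrite !mulrnBl -!mulrnA [(m' * m)%N]mulnC addrC addrA subrK.
by rewrite mulrnBr ?opprB// ltnW.
Qed.

Lemma value_ge w g k p m : descending w -> g <= u ->
  forces (w k) (g *+ m.+1 - u *+ p) -> p%:R / m.+1%:R <= value w g.
Proof.
move=> dw gu h; apply: ub_le_sup; last by exists p, m; split=> //; exists k.
exists 1 => _ [p' [m' [-> [k' h']]]].
have hu : forces (w 0%N) (u *+ 1 - g *+ 1) by apply: forces_ge0; rewrite (po_subge0 po).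
have := forces_consistent dw h' hu.
by rewrite muln1 mul1n ler_pdivrMr ?ltr0Sn// mul1r ler_nat.
Qed.

Lemma value_le w g k p m : descending w -> 0 <= g ->
  forces (w k) (u *+ p - g *+ m.+1) -> value w g <= p%:R / m.+1%:R.
Proof.
move=> dw g0 h; apply: ge_sup.
  exists 0, 0%N, 0%N; rewrite mul0r; split=> //; exists 0%N.
  by apply: forces_ge0; rewrite mulr0n subr0.
move=> _ [p' [m' [-> [k' h']]]].
have := forces_consistent dw h' h.
by rewrite ler_pdivrMr ?ltr0Sn// mulrAC ler_pdivlMr ?ltr0Sn// -!natrM ler_nat.
Qed.

(** Take the least [p] for which [u *+ p] is forced above [g *+ N.+1]; its predecessor is not, so by
    decision it is forced below. *)
Lemma value_approx w g N : descending w -> 0 <= g <= u -> decides w g ->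
  exists p k, forces (w k) (g *+ N.+1 - u *+ p) /\ forces (w k) (u *+ p.+1 - g *+ N.+1).
Proof.
move=> dw /andP[g0 gu] dg.
pose P p := `[< exists k, forces (w k) (u *+ p - g *+ N.+1) >].
have exP : exists p, P p.
  exists N.+1; apply/asboolP; exists 0%N; apply: forces_ge0.
  by rewrite (po_subge0 po); exact: po_leMn.
case: (ex_minnP exP) => p /asboolP[k hk] pmin.
case: p hk pmin => [|p] hk pmin.
  (* The least bound may be [0]; weakening it to [u] keeps the shape [p], [p.+1]. *)
  exists 0%N, k; split; first by apply: forces_ge0; rewrite mulr0n subr0 po_Mn_ge0.
  have -> : u *+ 1 - g *+ N.+1 = u + (u *+ 0 - g *+ N.+1) by rewrite mulr0n sub0r mulr1n.
  by apply: forcesD => //; [exact: condition_lower (dw.1 k)|exact: forces_ge0].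
have [j [hj|hj]] := dg p N.+1; last first.
  suff : (p < p)%N by rewrite ltnn.
  by apply: pmin; apply/asboolP; exists j.
exists p, (maxn j k); split.
- by apply: forces_sub hj; apply: descending_sub => //; rewrite leq_maxl.
- by apply: forces_sub hk; apply: descending_sub => //; rewrite leq_maxr.
Qed.

Lemma value_ge0 w g : descending w -> 0 <= g <= u -> 0 <= value w g.
Proof.
move=> dw /andP[g0 gu]; have := @value_ge w g 0 0 0 dw gu; rewrite mul0r; apply.
by apply: forces_ge0; rewrite mulr0n subr0.
Qed.

Lemma value_unit w : descending w -> value w u = 1.
Proof.
move=> dw; apply/le_anti/andP; split.
- have := @value_le w u 0 1 0 dw u0; rewrite divr1; apply.
  by apply: forces_ge0; rewrite subrr.
- have := @value_ge w u 0 1 0 dw (lexx _); rewrite divr1; apply.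
  by apply: forces_ge0; rewrite subrr.
Qed.

Lemma natr_inv_small (x : R) : (forall N : nat, x <= 2 / N.+1%:R) -> x <= 0.
Proof.
move=> h; rewrite leNgt; apply/negP => x0.
have x2 : 0 <= 2 / x by rewrite divr_ge0// ltW.
have := archi_boundP x2; set N := Num.bound _; rewrite ltr_pdivrMr// => hN.
have := h N; rewrite ler_pdivlMr ?ltr0Sn// -natr1 => hN'.
by lra.
Qed.

Lemma valueD w g h : descending w -> 0 <= g -> 0 <= h -> g + h <= u ->
  decides w g -> decides w h -> value w (g + h) = value w g + value w h.
Proof.
move=> dw g0 h0 ghu dg dh.
have gu : g <= u by apply: le_trans ghu; rewrite po_lerDl.
have hu : h <= u by apply: le_trans ghu; rewrite po_lerDr.
(* Each of [g] and [h] is located in an interval of length [1 / N.+1], and [g + h] in one of twice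
   that length. *)
suff H N : `|value w (g + h) - (value w g + value w h)| <= 2 / N.+1%:R.
  by apply/eqP; rewrite -subr_eq0 -normr_le0; exact: natr_inv_small.
have [|p [k [pk pk']]] := @value_approx w g N dw _ dg; first by rewrite g0.
have [|q [l [ql ql']]] := @value_approx w h N dw _ dh; first by rewrite h0.
set i := maxn k l.
have low := condition_lower (dw.1 i).
have ki : w i `<=` w k by apply: descending_sub => //; rewrite leq_maxl.
have li : w i `<=` w l by apply: descending_sub => //; rewrite leq_maxr.
have lo := forcesD low (forces_sub ki pk) (forces_sub li ql).
have hi := forcesD low (forces_sub ki pk') (forces_sub li ql').
rewrite addrACA -opprD -mulrnDl -mulrnDr in lo.
rewrite addrACA -opprD -mulrnDl -mulrnDr addSn addnS in hi.
have := value_ge dw ghu lo; have := value_le dw (po_addr_ge0 po g0 h0) hi.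
have := value_ge dw gu pk; have := value_le dw g0 pk'.
have := value_ge dw hu ql; have := value_le dw h0 ql'.
have E r : r.+1%:R / N.+1%:R = r%:R / N.+1%:R + 1 / N.+1%:R :> R.
  by rewrite -natr1 mulrDl.
have -> : 2 / N.+1%:R = 1 / N.+1%:R + 1 / N.+1%:R :> R by rewrite -mulrDl.
rewrite !E natrD mulrDl.
move: (1 / _) (p%:R / _) (q%:R / _) (value w _) (value w _) (value w _) => z x y a b c *.
by rewrite ler_norml; apply/andP; split; lra.
Qed.

Lemma generically_valueB g h : 0 <= h -> h <= g -> g <= u ->
  generically (fun w => value w (g - h) = value w g - value w h).
Proof.
move=> h0 hg gu; apply: generically_imp (generically_and (generically_decides (g - h))
  (generically_decides h)) => w dw [dgh dh].
have gh0 : 0 <= g - h by rewrite (po_subge0 po).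
have := valueD dw gh0 h0; rewrite subrK => /(_ gu dgh dh) ->.
by rewrite addrK.
Qed.

Lemma generically_value_lub (g : nat -> G) s : nondec g -> is_lub g s ->
  0 <= g 0%N -> s <= u ->
  generically (fun w => forall N, exists k, value w s <= value w (g k) + 1 / N.+1%:R).
Proof.
move=> ndg gs g0 su; have gk0 k : 0 <= g k by apply: le_trans g0 _; exact: ndg.
have /generically_forall h1 := fun k => generically_decides (g k).
have /generically_forall h2 := fun k => generically_decides (s - g k).
have /generically_forall h3 : forall m : nat, generically (fun w => exists j,
    [set L | exists k, forces L (u - (s - g k) *+ m.+1)] (w j)).
  move=> m; apply: generically_dense => L cL.
  have [k [L' [L'L cL' h]]] := condition_lub m.+1 ndg gs cL.
  by exists L'; split=> //; exists k.
apply: generically_imp (generically_and (generically_and h1 h2) h3) => w dw [[d1 d2] d3] N.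
have [j [k hjk]] := d3 N; exists k.
have d0 : 0 <= s - g k by rewrite (po_subge0 po); exact: gs.1.
have -> : value w s = value w (g k) + value w (s - g k).
  by rewrite -valueD// addrC subrK.
by rewrite lerD2l; exact: (@value_le w (s - g k) j 1 N dw d0 hjk).
Qed.

(** If [h - g] is not nonnegative, some condition makes a multiple of [g - h] exceed [u]; a generic
    sequence starting there gives [g] a strictly larger value than [h]. *)
Lemma generically_value_le g h : 0 <= g <= u -> 0 <= h <= u ->
  generically (fun w => value w g <= value w h) -> g <= h.
Proof.
move=> /andP[g0 gu] /andP[h0 hu] gh; rewrite -(po_subge0 po); apply: contrapT => hg.
have [|L [m [cL Lm]]] := @condition_negative (h - g) 1%N _ hg.
  by rewrite opprB mulr1n (po_leBlDr po) (le_trans gu)// po_lerDl.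
have [w [dw w0 [vgh dh]]] := generically_exists (generically_and gh (generically_decides h)) cL.
case: m Lm => [|m] Lm.
  by have := @condition_consistent L 1 cL; rewrite mulr1n -[- u]add0r -{1}oppr0 => /(_ Lm).
(* The denominator is twice the multiplier, so [g] gains two units over [h], more than the one unit
   of uncertainty about [h]. *)
have [|p [k [pk pk']]] := @value_approx w h (m.+1 * 2).-1 dw _ dh; first by rewrite h0.
have vh := value_le dw h0 pk'; rewrite prednK ?muln_gt0// in pk.
have low := condition_lower (dw.1 k).
have : forces (w k) (- ((h - g) *+ m.+1) - u).
  by apply: forces_sub Lm; rewrite -w0; exact: descending_sub.
move=> /(forcesMn (k := 2) low) hm.
have := forcesD low hm pk.
have -> : (- ((h - g) *+ m.+1) - u) *+ 2 + (h *+ (m.+1 * 2) - u *+ p) =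
    g *+ (m.+1 * 2) - u *+ p.+2.
  rewrite mulrnBl -[- ((h - g) *+ m.+1)]mulNrn opprB -mulrnA mulrnBl -[p.+2]addn2 mulrnDr.
  by rewrite addrACA subrK -opprD [u *+ p + _]addrC.
rewrite -[X in g *+ X]prednK ?muln_gt0// => /(value_ge dw gu) vg.
have := le_trans (le_trans vg vgh) vh.
by rewrite ler_pM2r ?invr_gt0 ?ltr0Sn// ler_nat ltnn.
Qed.

End Values.

End Forcing.

(** * Measures on the Cantor space *)

(* A finite bit string lists the most recent bit first. *)
Fixpoint prefix_rev (c : nat -> bool) (k : nat) : seq bool :=
  if k is j.+1 then c j :: prefix_rev c j else [::].

Definition cylinder (s : seq bool) : set (nat -> bool) :=
  [set c | prefix_rev c (size s) = s].

(** The empty set is included so that the class is closed under intersection: two cylinders are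
    nested or disjoint. *)
Definition cylinders : set (set (nat -> bool)) :=
  [set A | A = set0 \/ exists s, A = cylinder s].

Definition cantor_borel : set (set (nat -> bool)) := <<s cylinders >>.

Lemma size_prefix_rev c k : size (prefix_rev c k) = k.
Proof. by elim: k => //= k ->. Qed.

Lemma cylinder_nil : cylinder [::] = setT.
Proof. by apply/seteqP; split. Qed.

Lemma cylinder_cons b s : cylinder (b :: s) = cylinder s `&` [set c | c (size s) = b].
Proof.
apply/seteqP; split=> c /=; first by case=> -> h; split.
by case; rewrite /cylinder /= => -> ->.
Qed.

Lemma drop_prefix_rev c j k : drop j (prefix_rev c (j + k)) = prefix_rev c k.
Proof. by elim: j => [|j IH] /=; rewrite ?drop0. Qed.

Lemma cylinders_setI : setI_closed cylinders.
Proof.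
have sym A B : cylinders (A `&` B) -> cylinders (B `&` A) by rewrite setIC.
have nest s t : (size s <= size t)%N -> cylinders (cylinder s `&` cylinder t).
  move=> st; have E c : cylinder t c -> prefix_rev c (size s) = drop (size t - size s) t.
    by move=> <-; rewrite size_prefix_rev -{2}(subnK st) drop_prefix_rev.
  have [h|h] := pselect (drop (size t - size s) t = s).
    right; exists t; apply/seteqP; split=> c [] // tc; split=> //.
    by rewrite /cylinder /= E.
  by left; apply/seteqP; split=> c // -[sc /E]; rewrite sc => /esym.
move=> A B [->|[s ->]]; first by rewrite set0I; left.
move=> [->|[t ->]]; first by rewrite setI0; left.
by case: (leqP (size s) (size t)) => [|/ltnW] /nest // /sym.
Qed.

Lemma g_sigma_setT (T : Type) (C : set (set T)) : <<s C >> setT.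
Proof. by move=> A [[A0 AD _] _]; rewrite -(setD0 setT); exact: AD. Qed.

Lemma g_sigma_set0 (T : Type) (C : set (set T)) : <<s C >> set0.
Proof. by move=> A [[A0 AD _] _]. Qed.

Lemma g_sigma_bigcup (T : Type) (C : set (set T)) (A : nat -> set T) :
  (forall k, <<s C >> (A k)) -> <<s C >> (\bigcup_k A k).
Proof. by move=> h B CB; have [[_ _ BU] _] := CB; apply: BU => k; exact: h. Qed.

Lemma g_sigma_setC (T : Type) (C : set (set T)) A : <<s C >> A -> <<s C >> (~` A).
Proof. by move=> h B CB; have [[_ BD _] _] := CB; rewrite -setTD; apply: BD; exact: h. Qed.

Lemma g_sigma_setU (T : Type) (C : set (set T)) A B :
  <<s C >> A -> <<s C >> B -> <<s C >> (A `|` B).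
Proof.
move=> hA hB; rewrite -bigcup2E; apply: g_sigma_bigcup => -[|[|k]] //=.
exact: g_sigma_set0.
Qed.

Lemma g_sigma_setI (T : Type) (C : set (set T)) A B :
  <<s C >> A -> <<s C >> B -> <<s C >> (A `&` B).
Proof.
move=> hA hB; rewrite -(setCK (A `&` B)) setCI.
exact: (g_sigma_setC (g_sigma_setU (g_sigma_setC hA) (g_sigma_setC hB))).
Qed.

Lemma g_sigma_setD (T : Type) (C : set (set T)) A B :
  <<s C >> A -> <<s C >> B -> <<s C >> (A `\` B).
Proof. by move=> hA hB; rewrite setDE; exact: (g_sigma_setI hA (g_sigma_setC hB)). Qed.

(** * Real masses on the binary tree as images of Lebesgue measure *)

Section RealMeasure.
Variables (R : realType) (mu : seq bool -> R).
Hypotheses (mu0 : forall s, 0 <= mu s) (mu1 : mu [::] = 1).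
Hypothesis muD : forall s, mu s = mu (true :: s) + mu (false :: s).

(* The half-open interval attached to [s] has length [mu s]; the two intervals of
   the extensions of [s] divide it. *)
Fixpoint left_end (s : seq bool) : R :=
  if s is b :: s' then (if b then left_end s' else left_end s' + mu (true :: s')) else 0.

Fixpoint digits_rev (y : R) (k : nat) : seq bool :=
  if k is j.+1 then
    (y < left_end (digits_rev y j) + mu (true :: digits_rev y j)) :: digits_rev y j
  else [::].

Definition digit (y : R) (k : nat) : bool :=
  y < left_end (digits_rev y k) + mu (true :: digits_rev y k).

Lemma prefix_rev_digit y k : prefix_rev (digit y) k = digits_rev y k.
Proof. by elim: k => //= k ->. Qed.

(** The intervals of the strings of a given length partition [[0, 1[], and [digit] reads off the
    branch of intervals that contain [y]. *)
Lemma digit_cylinder s :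
  `[0, 1[ `&` digit @^-1` cylinder s = [set` `[left_end s, left_end s + mu s[ ].
Proof.
elim: s => [|b s IH].
  by rewrite cylinder_nil preimage_setT setIT /= mu1 add0r.
rewrite cylinder_cons preimage_setI setIA IH.
have dE y : `[left_end s, left_end s + mu s[%classic y ->
    digit y (size s) = (y < left_end s + mu (true :: s)).
  rewrite -IH => -[_]; rewrite /preimage /cylinder /= prefix_rev_digit => h.
  by rewrite /digit h.
have h1 := mu0 (true :: s); have h2 := mu0 (false :: s); have h3 := muD s.
apply/seteqP; split=> y /=; rewrite !in_itv /=.
  move=> [/andP[h4 h5]]; rewrite dE /=; last by rewrite in_itv /= h4.
  case: b => [->|]; first by rewrite h4.
  by move=> /negbT; rewrite -leNgt => ->; rewrite /= -addrA -h3.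
move=> yb.
have ys : left_end s <= y < left_end s + mu s.
  by case: b yb => /andP[h4 h5]; apply/andP; split; lra.
split=> //; rewrite dE /= ?in_itv//=.
case: b yb => /andP[h4 h5] //.
by apply/negbTE; rewrite -leNgt.
Qed.

Lemma digit_measurable A : cantor_borel A -> measurable (`[0, 1[ `&` digit @^-1` A).
Proof.
pose H := [set A | measurable (`[0, 1[ `&` digit @^-1` A : set R)].
suff : cantor_borel `<=` H by apply.
apply: smallest_sub; last first.
  move=> _ [->|[s ->]]; rewrite /H /=; first by rewrite preimage_set0 setI0.
  by rewrite digit_cylinder; exact: measurable_itv.
split; rewrite /H /=.
- by rewrite preimage_set0 setI0.
- move=> B mB; rewrite setTD preimage_setC -setDE.
  rewrite -[X in measurable X]set0U -(setDv `[0, 1[%classic) -setDIr.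
  by apply: measurableD => //; exact: measurable_itv.
- move=> B mB; rewrite preimage_bigcup setI_bigcupr.
  by apply: bigcup_measurable => k _; exact: mB.
Qed.

Definition real_extension (A : set (nat -> bool)) : R :=
  fine (lebesgue_measure (`[0, 1[ `&` digit @^-1` A : set R)).

Let mset (A : set (nat -> bool)) : set R := `[0, 1[ `&` digit @^-1` A.

Let mset_fin A : cantor_borel A -> lebesgue_measure (mset A) \is a fin_num.
Proof.
move=> mA; rewrite ge0_fin_numE//.
apply: (@le_lt_trans _ _ (lebesgue_measure (`[0, 1[%classic : set R))).
  by apply: le_measure; rewrite ?inE; [exact: digit_measurable|exact: measurable_itv|exact: subIsetl].
by rewrite lebesgue_measure_itv /= lte_fin ltr01 sube0 ltry.
Qed.

Lemma real_extension_ge0 A : 0 <= real_extension A.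
Proof. exact: fine_ge0. Qed.

Lemma real_extension_cylinder s : real_extension (cylinder s) = mu s.
Proof.
rewrite /real_extension digit_cylinder lebesgue_measure_itv /= lte_fin ltrDl.
have [s0|s0] := ltP 0 (mu s); first by rewrite -EFinB /= addrC addKr.
by apply/le_anti; rewrite s0 mu0.
Qed.

Lemma real_extensionU A B : cantor_borel A -> cantor_borel B -> A `&` B = set0 ->
  real_extension (A `|` B) = real_extension A + real_extension B.
Proof.
move=> mA mB AB; rewrite /real_extension preimage_setU setIUr measureU.
- by rewrite fineD//; exact: mset_fin.
- exact: digit_measurable.
- exact: digit_measurable.
- by apply/seteqP; split=> // y [[_ Ay] [_ By]]; suff : (A `&` B) (digit y) by rewrite AB.
Qed.

Lemma real_extension_cvg (A : nat -> set (nat -> bool)) :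
  (forall k, cantor_borel (A k)) -> (forall k, A k `<=` A k.+1) ->
  forall e, 0 < e -> exists k, real_extension (\bigcup_k A k) <= real_extension (A k) + e.
Proof.
move=> mA ndA e e0.
have E : mset (\bigcup_k A k) = \bigcup_k mset (A k).
  by rewrite /mset preimage_bigcup setI_bigcupr.
have mU : cantor_borel (\bigcup_k A k) by exact: g_sigma_bigcup.
have : (fun k => lebesgue_measure (mset (A k))) @ \oo --> lebesgue_measure (\bigcup_k mset (A k)).
  apply: nondecreasing_cvg_mu.
  - by move=> k; exact: digit_measurable.
  - by rewrite -E; exact: digit_measurable.
  - apply/nondecreasing_seqP => k; apply/subsetPset; apply: setIS.
    by move=> y /=; exact: ndA.
rewrite -E -(fineK (mset_fin mU)) => /fine_cvg /cvgrPdist_le /(_ _ e0)[k _ /(_ k (leqnn k))].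
move=> /= h; exists k; rewrite addrC -lerBlDr; apply: le_trans h; exact: ler_norm.
Qed.

End RealMeasure.

(** * Group values for the Borel sets of the Cantor space *)

Section CantorExtension.
Variables (R : realType) (G : porderZmodType) (po : po_group G).
Hypotheses (dir : directed_group G) (ic : integrally_closed G).
Hypothesis sc : monotone_sigma_complete G.
Variable m : seq bool -> G.
Hypothesis m0 : forall s, 0 <= m s.
Hypothesis mD : forall s, m s = m (true :: s) + m (false :: s).

Let u := m [::].
Let u0 : 0 <= u := m0 [::].

Lemma mass_le_total s : m s <= u.
Proof.
elim: s => [|b s IH]; first exact: lexx.
apply: le_trans IH; rewrite [leRHS]mD; case: b; first by rewrite po_lerDl.
by rewrite po_lerDr.
Qed.

Lemma mass_bounds s : 0 <= m s <= u.
Proof. by rewrite m0 mass_le_total. Qed.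

(** There are only countably many strings, so a generic sequence decides all their masses at once
    and turns [m] into a real mass of total [1]. *)
Lemma generically_measure : exists P : (nat -> set G) -> set (nat -> bool) -> R,
  generically u (fun w =>
    [/\ forall s, P w (cylinder s) = value u R w (m s),
        forall A, 0 <= P w A,
        forall A B, cantor_borel A -> cantor_borel B -> A `&` B = set0 ->
          P w (A `|` B) = P w A + P w B &
        forall A : nat -> set (nat -> bool), (forall k, cantor_borel (A k)) ->
          (forall k, A k `<=` A k.+1) -> forall e, 0 < e ->
          exists k, P w (\bigcup_k A k) <= P w (A k) + e]).
Proof.
exists (fun w => real_extension (fun s => value u R w (m s))).
have /generically_forall : forall s, generically u (fun w => decides u w (m s)).
  by move=> s; exact: generically_decides.
apply: generically_imp => w dw dm.
have v0 s : 0 <= value u R w (m s) by apply: value_ge0 => //; exact: mass_bounds.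
have v1 : value u R w (m [::]) = 1 by exact: value_unit.
have vD s : value u R w (m s) = value u R w (m (true :: s)) + value u R w (m (false :: s)).
  by rewrite {1}mD [LHS]valueD// -mD; exact: mass_le_total.
split.
- exact: real_extension_cylinder.
- exact: real_extension_ge0.
- exact: real_extensionU.
- exact: real_extension_cvg.
Qed.

Lemma cantor_extension : exists nu : set (nat -> bool) -> G,
  [/\ forall A, cantor_borel A -> 0 <= nu A,
      forall A B, cantor_borel A -> cantor_borel B -> A `&` B = set0 ->
        nu (A `|` B) = nu A + nu B,
      forall A : nat -> set (nat -> bool), (forall k, cantor_borel (A k)) ->
        (forall k, A k `<=` A k.+1) -> is_lub (fun k => nu (A k)) (nu (\bigcup_k A k)) &
      forall s, nu (cylinder s) = m s].
Proof.
have [P gP] := generically_measure.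
pose represents A g := 0 <= g <= u /\ generically u (fun w => value u R w g = P w A).
have rep_le A B g h : represents A g -> represents B h ->
    generically u (fun w => P w A <= P w B) -> g <= h.
  move=> [gb gA] [hb hB] AB; apply: (generically_value_le (R := R) po dir ic u0 gb hb).
  by apply: generically_imp (generically_and (generically_and gA hB) AB) => w _ [[-> ->]].
have rep_unique A g h : represents A g -> represents A h -> g = h.
  move=> gA hA; apply/le_anti/andP; split; [apply: rep_le gA hA _|apply: rep_le hA gA _];
  by apply: generically_true.
have PD A B : cantor_borel A -> cantor_borel B -> B `<=` A ->
    generically u (fun w => P w A = P w (A `\` B) + P w B).
  move=> mA mB BA; apply: generically_imp gP => w _ [_ _ PU _].
  rewrite -PU ?setDKU//; first exact: g_sigma_setD mA mB.
  by rewrite setDKI.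
have repD A B g h : cantor_borel A -> cantor_borel B -> B `<=` A ->
    represents A g -> represents B h -> represents (A `\` B) (g - h).
  move=> mA mB BA gA hB.
  have hg : h <= g.
    apply: rep_le hB gA _; apply: generically_imp (generically_and gP (PD A B mA mB BA)).
    by move=> w _ [[_ P0 _ _] ->]; rewrite lerDr.
  have [/andP[g0 gu] gA'] := gA; have [/andP[h0 hu] hB'] := hB.
  split; first by rewrite (po_subge0 po) hg (le_trans _ gu)// po_lerBl.
  apply: generically_imp (generically_and (generically_and gA' hB') (generically_and
    (generically_valueB po dir ic u0 R h0 hg gu) (PD A B mA mB BA))).
  by move=> w _ [[vA vB] [-> E]]; rewrite vA vB E addrK.
(* The supremum is taken in [G]; [generically_value_lub] identifies its value with the limit of the
   real measures. *)
have rep_lub (A : nat -> set (nat -> bool)) (g : nat -> G) :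
    (forall k, cantor_borel (A k)) -> (forall k, A k `<=` A k.+1) ->
    (forall k, represents (A k) (g k)) ->
    exists2 s, is_lub g s & represents (\bigcup_k A k) s.
  move=> mA ndA rA.
  have PA B C : cantor_borel B -> cantor_borel C -> B `<=` C ->
      generically u (fun w => P w B <= P w C).
    move=> mB mC BC; apply: generically_imp (generically_and gP (PD C B mC mB BC)).
    by move=> w _ [[_ P0 _ _] ->]; rewrite lerDr.
  have ndg : nondec g.
    by apply: nondec_step => k; apply: rep_le (rA k) (rA k.+1) _; exact: PA.
  have [|s gs] := nondec_lub sc ndg (b := u); first by move=> k; case/andP: (rA k).1.
  have su : s <= u by apply: gs.2 => k; case/andP: (rA k).1.
  have g0 : 0 <= g 0%N by case/andP: (rA 0%N).1.
  exists s => //; split; first by rewrite su andbT (le_trans g0)// gs.1.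
  have mU : cantor_borel (\bigcup_k A k) by exact: g_sigma_bigcup.
  have /generically_forall h1 := fun k => (rA k).2.
  have /generically_forall h2 : forall k, generically u (fun w => value u R w (g k) <= value u R w s).
    move=> k; have gk0 : 0 <= g k by case/andP: (rA k).1.
    apply: generically_imp (generically_valueB po dir ic u0 R gk0 (gs.1 k) su) => w dw E.
    rewrite -subr_ge0 -E; apply: value_ge0 => //.
    by rewrite (po_subge0 po) gs.1 (le_trans _ su)// po_lerBl.
  have /generically_forall h3 : forall k, generically u (fun w => P w (A k) <= P w (\bigcup_k A k)).
    by move=> k; apply: PA => //; exact: bigcup_sup.
  have h4 := generically_value_lub po dir ic u0 R ndg gs g0 su.
  apply: generically_imp (generically_and (generically_and (generically_and h1 h2)
    (generically_and h3 h4)) gP) => w dw [[[vA vs] [PA' vlub]] [_ _ _ Pcvg]].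
  apply/le_anti/andP; split; apply/ler_addgt0Pr => e e0.
    have := archi_boundP (ltW (divr_gt0 (ltr01 : 0 < 1 :> R) e0)); set N := Num.bound _ => hN.
    have [k hk] := vlub N; apply: (le_trans hk); rewrite vA lerD//.
    rewrite ler_pdivrMr// mulrC -ler_pdivrMr// (le_trans (ltW hN))// ler_nat.
    exact: leqnSn.
  have [k hk] := Pcvg _ mA ndA _ e0; apply: (le_trans hk).
  by rewrite lerD2r -vA.
have rep_cylinder s : represents (cylinder s) (m s).
  split; first exact: mass_bounds.
  by apply: generically_imp gP => w _ [-> _ _ _].
have ex_rep : cantor_borel `<=` [set A | cantor_borel A /\ exists g, represents A g].
  apply: (lambda_system_subset cylinders_setI) => //.
  - split=> //.
    + by split; [exact: g_sigma_setT|exists u; rewrite -cylinder_nil; exact: rep_cylinder].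
    + move=> A B BA [mA [g gA]] [mB [h hB]]; split; first exact: g_sigma_setD.
      by exists (g - h); exact: repD.
    + move=> A ndA hA; split; first by apply: g_sigma_bigcup => k; case: (hA k).
      have /choice[g gP'] := fun k => (hA k).2.
      have [||s _ rs] := rep_lub A g _ _ gP'.
      * by move=> k; case: (hA k).
      * by move=> k; apply/subsetPset/ndA.
      * by exists s.
  - move=> A hA; split; first exact: sub_sigma_algebra.
    case: hA => [->|[s ->]]; last by exists (m s).
    (* The empty set is the full cylinder minus itself. *)
    exists (u - u); rewrite -(setDv (cylinder [::])).
    have mT : cantor_borel (cylinder [::]) by rewrite cylinder_nil; exact: g_sigma_setT.
    exact: repD.
pose nu A := xget 0 [set g | represents A g].
have nuP A : cantor_borel A -> represents A (nu A).
  by move=> /ex_rep[_]; apply: (@xgetPex _ 0 [set g | represents A g]).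
exists nu; split.
- by move=> A /nuP[/andP[]].
- move=> A B mA mB AB; have mU := g_sigma_setU mA mB.
  have := repD _ _ _ _ mU mB (@subsetUr _ A B) (nuP _ mU) (nuP _ mB).
  have -> : (A `|` B) `\` B = A.
    by rewrite setDUl setDv setU0; apply/setDidPl.
  by move=> h; rewrite (rep_unique _ _ _ (nuP _ mA) h) subrK.
- move=> A mA ndA; have [s ls rs] := rep_lub A (fun k => nu (A k)) mA ndA (fun k => nuP _ (mA k)).
  by rewrite -(rep_unique _ _ _ rs (nuP _ _))//; exact: g_sigma_bigcup.
- move=> s; apply: rep_unique (nuP _ _) (rep_cylinder s).
  by apply: sub_sigma_algebra; right; exists s.
Qed.

End CantorExtension.

(** * Volumes of boxes *)

Section Boxes.
Variables (R : realType) (n : nat).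
Implicit Types (a b p s t : 'rV[R]_n) (i j : 'I_n) (l : seq 'I_n).

Definition le_coord s t : Prop := forall i, s 0 i <= t 0 i.

Lemma set_coordE t i (x : R) j : set_coord t i x 0 j = if j == i then x else t 0 j.
Proof. by rewrite mxE. Qed.

Lemma set_coord_same t i : set_coord t i (t 0 i) = t.
Proof. by apply/rowP => j; rewrite set_coordE; case: eqP => // ->. Qed.

Lemma set_coord_le t i (x : R) : x <= t 0 i -> le_coord (set_coord t i x) t.
Proof. by move=> h j; rewrite set_coordE; case: eqP => // ->. Qed.

Lemma le_set_coord s t i (x y : R) : le_coord s t -> x <= y ->
  le_coord (set_coord s i x) (set_coord t i y).
Proof. by move=> st xy j; rewrite !set_coordE; case: eqP. Qed.

(** The intermediate rows [r l] have the coordinates listed in [l] already replaced and stay between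
    [s] and [t]. *)
Lemma le_coord_path (Q : 'rV[R]_n -> Prop) s t : le_coord s t ->
  (forall r i, le_coord s r -> le_coord r t -> Q r -> Q (set_coord r i (s 0 i))) ->
  Q t -> Q s.
Proof.
move=> st step Qt.
pose r l : 'rV[R]_n := \row_j (if j \in l then s 0 j else t 0 j).
have sr l : le_coord s (r l) by move=> j; rewrite mxE; case: ifP.
have rt l : le_coord (r l) t by move=> j; rewrite mxE; case: ifP.
have Qr l : Q (r l).
  elim: l => [|i l IH]; first by rewrite (_ : r [::] = t)//; apply/rowP => j; rewrite mxE.
  rewrite (_ : r (i :: l) = set_coord (r l) i (s 0 i)); last first.
    by apply/rowP => j; rewrite set_coordE !mxE inE; case: eqP => [->|].
  exact: step.
by rewrite (_ : s = r (enum 'I_n))//; apply/rowP => j; rewrite mxE mem_enum.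
Qed.

Lemma le_coord_path_up (Q : 'rV[R]_n -> Prop) s t : le_coord s t ->
  (forall r i, le_coord s r -> le_coord r t -> Q r -> Q (set_coord r i (t 0 i))) ->
  Q s -> Q t.
Proof.
move=> st step Qs.
pose r l : 'rV[R]_n := \row_j (if j \in l then t 0 j else s 0 j).
have sr l : le_coord s (r l) by move=> j; rewrite mxE; case: ifP.
have rt l : le_coord (r l) t by move=> j; rewrite mxE; case: ifP.
have Qr l : Q (r l).
  elim: l => [|i l IH]; first by rewrite (_ : r [::] = s)//; apply/rowP => j; rewrite mxE.
  rewrite (_ : r (i :: l) = set_coord (r l) i (t 0 i)); last first.
    by apply/rowP => j; rewrite set_coordE !mxE inE; case: eqP => [->|].
  exact: step.
by rewrite (_ : t = r (enum 'I_n))//; apply/rowP => j; rewrite mxE mem_enum.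
Qed.

Section Volume.
Variable V : zmodType.
Implicit Type f : 'rV[R]_n -> V.

(* Clipping [a] to [b] makes the difference vanish, instead of changing sign, on an
   interval with [b < a]. *)
Fixpoint mixed_diff l a b f p : V :=
  if l is i :: l' then mixed_diff l' a b f (set_coord p i (b 0 i)) -
    mixed_diff l' a b f (set_coord p i (Num.min (a 0 i) (b 0 i)))
  else f p.

(** Every coordinate of the base point gets overwritten; taking [b] makes [mixed_diff_approx]
    applicable, which compares with the value at the base point. *)
Definition box f a b : V := mixed_diff (enum 'I_n) a b f b.

Lemma eq_mixed_diff l a b p a' b' p' f :
  (forall i, i \in l -> a 0 i = a' 0 i /\ b 0 i = b' 0 i) ->
  (forall i, i \notin l -> p 0 i = p' 0 i) ->
  mixed_diff l a b f p = mixed_diff l a' b' f p'.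
Proof.
elim: l p p' => [|i l IH] p p' ab pp /=.
  by congr f; apply/rowP => i; exact: pp.
have [ai bi] := ab i (mem_head _ _).
have ab' j : j \in l -> a 0 j = a' 0 j /\ b 0 j = b' 0 j.
  by move=> jl; apply: ab; rewrite inE jl orbT.
rewrite ai bi; congr (_ - _); apply: IH => // j jl; rewrite !set_coordE;
  by case: eqP => // /eqP ji; apply: pp; rewrite inE negb_or ji.
Qed.

(** The difference in direction [i] telescopes at [q]; clipping also covers a [q] outside the
    interval, where one of the two parts vanishes. *)
Lemma mixed_diff_split l a b p f i (q : R) : uniq l -> i \in l ->
  mixed_diff l a b f p = mixed_diff l a (set_coord b i (Num.min (b 0 i) q)) f p +
    mixed_diff l (set_coord a i (Num.max (a 0 i) q)) b f p.
Proof.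
elim: l p => [//|j l IH] p /= /andP[jl ul].
rewrite inE => /orP[/eqP ij|il]; last first.
  have ji : j == i = false by apply/negbTE; apply: contraNneq jl => ->.
  rewrite !set_coordE ji [mixed_diff l a b f _]IH// [X in _ - X]IH//.
  by rewrite opprD addrACA.
subst j.
pose K x := mixed_diff l a b f (set_coord p i x).
have E1 x : mixed_diff l a (set_coord b i (Num.min (b 0 i) q)) f (set_coord p i x) = K x.
  apply: eq_mixed_diff => // j jl'; rewrite set_coordE; case: eqP => // ji.
  by rewrite ji (negbTE jl) in jl'.
have E2 x : mixed_diff l (set_coord a i (Num.max (a 0 i) q)) b f (set_coord p i x) = K x.
  apply: eq_mixed_diff => // j jl'; rewrite set_coordE; case: eqP => // ji.
  by rewrite ji (negbTE jl) in jl'.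
rewrite !E1 !E2 -!/(K _) !set_coordE eqxx.
move: (a 0 i) (b 0 i) => x y.
have [yq|qy] := leP y q.
  rewrite (_ : Num.min (Num.max x q) y = y) ?subrr ?addr0//.
  by apply/min_idPr; rewrite le_max yq orbT.
have [xq|qx] := leP x q.
  rewrite (min_idPl (le_trans xq (ltW qy))) (min_idPl (ltW qy)).
  by rewrite [RHS]addrC addrA subrK.
by rewrite subrr add0r.
Qed.

Lemma box_split f a b i (q : R) :
  box f a b = box f a (set_coord b i (Num.min (b 0 i) q)) +
    box f (set_coord a i (Num.max (a 0 i) q)) b.
Proof.
rewrite /box (mixed_diff_split _ _ _ _ q (enum_uniq _) (mem_enum _ i)); congr (_ + _).
by apply: eq_mixed_diff => // j; rewrite mem_enum.
Qed.

Lemma mixed_diff_min l a b p f : mixed_diff l a b f p =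
  mixed_diff l (\row_i Num.min (a 0 i) (b 0 i)) b f p.
Proof. by elim: l p => //= i l IH p; rewrite !IH mxE -minA minxx. Qed.

Lemma mixed_diff_empty l a b p f i : uniq l -> i \in l -> b 0 i <= a 0 i ->
  mixed_diff l a b f p = 0.
Proof.
move=> ul + ba; elim: l ul p => [//|j l IH] /= /andP[jl ul] p.
rewrite inE => /orP[/eqP<-|il]; last by rewrite !IH// subrr.
by rewrite (min_idPr ba) subrr.
Qed.

Lemma box_empty f a b i : b 0 i <= a 0 i -> box f a b = 0.
Proof. by apply: mixed_diff_empty; [exact: enum_uniq|rewrite mem_enum]. Qed.

Lemma mixed_diffD l a b f g p :
  mixed_diff l a b (fun t => f t + g t) p = mixed_diff l a b f p + mixed_diff l a b g p.
Proof. by elim: l p => //= i l IH p; rewrite !IH opprD addrACA. Qed.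

Lemma boxD f g a b : box (fun t => f t + g t) a b = box f a b + box g a b.
Proof. exact: mixed_diffD. Qed.

End Volume.

Lemma mixed_diff_additive (V W : zmodType) (h : V -> W) l a b p f :
  {morph h : x y / x - y} -> h (mixed_diff l a b f p) = mixed_diff l a b (h \o f) p.
Proof. by move=> hB; elim: l p => //= i l IH p; rewrite hB !IH. Qed.

Section Distribution.
Variables (H : porderZmodType) (po : po_group H).
Implicit Type f : 'rV[R]_n -> H.

(** Moving one face at a time removes a slab, which is itself a box of nonnegative volume. *)
Lemma box_mono f a b a' b' : (forall c d, 0 <= box f c d) ->
  le_coord a a' -> le_coord b' b -> box f a' b' <= box f a b.
Proof.
move=> f0 aa bb; apply: (@le_trans _ _ (box f a b')).
- apply: (le_coord_path_up (Q := fun r => box f r b' <= box f a b') aa) => // r i _ ra.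
  apply: le_trans; rewrite (box_split f r b' i (a' 0 i)).
  by rewrite (max_idPr (ra i)) po_lerDr.
- apply: (le_coord_path (Q := fun r => box f a r <= box f a b) bb) => // r i br _.
  apply: le_trans; rewrite (box_split f a r i (b' 0 i)).
  by rewrite (min_idPr (br i)) po_lerDl.
Qed.

Record distribution f : Prop := {
  dist_box : forall a b, 0 <= box f a b;
  dist_ge0 : forall t, 0 <= f t;
  dist_mono : forall s t, le_coord s t -> f s <= f t;
  dist_bottom : forall i t, is_lub (fun N : nat => - f (set_coord t i (- N%:R))) 0 }.

(** The difference is a signed sum of [2 ^ size l] values, each between [0] and [f p]. *)
Lemma mixed_diff_bound l a b p f : (forall t, 0 <= f t) ->
  (forall s t, le_coord s t -> f s <= f t) ->
  uniq l -> (forall i, i \in l -> b 0 i <= p 0 i) ->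
  - (f p *+ 2 ^ size l) <= mixed_diff l a b f p <= f p *+ 2 ^ size l.
Proof.
move=> f0 fm; elim: l p => [|i l IH] p /=.
  by rewrite expn0 mulr1n lexx andbT (le_trans _ (f0 p))// po_oppr_le0.
move=> /andP[il ul] bp; have bi : b 0 i <= p 0 i by apply: bp; rewrite mem_head.
have IHx x : x <= b 0 i -> - (f p *+ 2 ^ size l) <= mixed_diff l a b f (set_coord p i x)
    <= f p *+ 2 ^ size l.
  move=> xb; have px : le_coord (set_coord p i x) p.
    by apply: set_coord_le; exact: le_trans bi.
  have /andP[h1 h2] : - (f (set_coord p i x) *+ 2 ^ size l) <=
      mixed_diff l a b f (set_coord p i x) <= f (set_coord p i x) *+ 2 ^ size l.
    apply: IH => // j jl; rewrite set_coordE; case: eqP => [ji|_]; last first.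
      by apply: bp; rewrite inE jl orbT.
    by rewrite -ji jl in il.
  have h3 := po_leMn po (2 ^ size l) (fm _ _ px).
  by rewrite (le_trans h2 h3) andbT (le_trans _ h1)// po_leN.
have /andP[h1 h2] := IHx _ (lexx _).
have mb : Num.min (a 0 i) (b 0 i) <= b 0 i by rewrite ge_min lexx orbT.
have /andP[h3 h4] := IHx _ mb.
rewrite expnS mulrnA mulr2n mulrnDl opprD; apply/andP; split; apply: (po_leD po) => //.
- by rewrite po_leN.
- by rewrite (po_leNl po).
Qed.

(** Every term of the expansion other than [f p] has some coordinate lowered to [a], so monotonicity
    bounds it by the summand of that coordinate; the power of two accounts for the number of
    terms. *)
Lemma mixed_diff_approx l a b p f : (forall t, 0 <= f t) ->
  (forall s t, le_coord s t -> f s <= f t) ->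
  uniq l -> (forall i, i \in l -> b 0 i = p 0 i) ->
  let e := (\sum_(i <- l) f (set_coord p i (Num.min (a 0 i) (p 0 i)))) *+ 2 ^ size l in
  f p - e <= mixed_diff l a b f p <= f p + e.
Proof.
move=> f0 fm; elim: l => [|i l IH] /=.
  by rewrite big_nil mul0rn subr0 addr0 lexx.
move=> /andP[il ul] bp; have bi : b 0 i = p 0 i by apply: bp; rewrite mem_head.
rewrite bi set_coord_same big_cons.
have /andP[h1 h2] := IH ul (fun j jl => bp j (mem_behead (s := i :: l) jl)).
set S := \sum_(_ <- _) _ in h1 h2 *; set r := set_coord p i _.
have S0 : 0 <= S by apply: po_sum_ge0.
have /andP[h3 h4] : - (f r *+ 2 ^ size l) <= mixed_diff l a b f r <= f r *+ 2 ^ size l.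
  apply: mixed_diff_bound => // j jl; rewrite set_coordE; case: eqP => [ji|_].
    by rewrite -ji jl in il.
  by rewrite bp// inE jl orbT.
have le2 : (f r + S) *+ 2 ^ size l <= (f r + S) *+ 2 ^ (size l).+1.
  apply: po_leMnr => //; first exact: po_addr_ge0.
  by rewrite leq_exp2l.
rewrite mulrnDl in le2; apply/andP; split.
- apply: (@le_trans _ _ (f p - (f r *+ 2 ^ size l + S *+ 2 ^ size l))).
    by rewrite po_leDl// po_leN.
  by rewrite opprD addrCA addrC; apply: (po_leD po) => //; rewrite po_leN.
- apply: (@le_trans _ _ (f p + (f r *+ 2 ^ size l + S *+ 2 ^ size l))).
    rewrite addrCA addrC; apply: (po_leD po) => //.
    by rewrite (po_leNl po).
  by rewrite po_leDl.
Qed.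

Lemma vanishing_sum (I : Type) (r : seq I) (g : I -> nat -> H) :
  (forall x N, g x N.+1 <= g x N) -> (forall x, is_lub (fun N => - g x N) 0) ->
  is_lub (fun N => - \sum_(x <- r) g x N) 0.
Proof.
move=> gd g0; elim: r => [|x r IH].
  rewrite (_ : (fun N => _) = fun=> 0); first exact: is_lub_const.
  by apply/funext => N; rewrite big_nil oppr0.
rewrite (_ : (fun N => _) = fun N => - g x N + - \sum_(x <- r) g x N); last first.
  by apply/funext => N; rewrite big_cons opprD.
rewrite -[X in is_lub _ X](addr0 0).
apply: is_lubD => //; apply: nondec_step => N; rewrite po_leN//; exact: po_le_sum.
Qed.

(** The box and [f t] differ by at most [e N], a fixed multiple of a finite sum of values with one
    coordinate tending to minus infinity; such sums decrease to [0]. *)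
Lemma box_lub f t : distribution f ->
  is_lub (fun N : nat => box f (\row__ (- N%:R)) t) (f t).
Proof.
move=> [f0 fge0 fm fbot].
pose a N : 'rV[R]_n := \row__ (- N%:R).
pose g i N := f (set_coord t i (Num.min (- N%:R) (t 0 i))).
pose e1 N := \sum_(i <- enum 'I_n) g i N.
pose e N := e1 N *+ 2 ^ size (enum 'I_n).
have gdec i N : g i N.+1 <= g i N.
  apply: fm; apply: le_set_coord; first by move=> j.
  by rewrite le_min !ge_min lerN2 ler_nat leqnSn lexx orbT.
have e1dec N : e1 N.+1 <= e1 N by exact: po_le_sum.
have e1_0 : is_lub (fun N => - e1 N) 0.
  apply: vanishing_sum gdec _ => i; split=> [N|y gy]; first by rewrite po_oppr_le0//; exact: fge0.
  apply: (fbot i t).2 => N; apply: le_trans (gy N); rewrite po_leN//.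
  by apply: fm; apply: le_set_coord; [move=> j|rewrite ge_min lexx].
have nde : nondec (fun N => - e N).
  by apply: nondec_step => N; rewrite po_leN//; exact: po_leMn.
have e0 : is_lub (fun N => - e N) 0.
  rewrite /e; elim: (2 ^ _)%N => [|k IH].
    rewrite (_ : (fun N => _) = fun=> 0); first exact: is_lub_const.
    by apply/funext => N; rewrite mulr0n oppr0.
  rewrite (_ : (fun N => _) = fun N => - e1 N + - (e1 N *+ k)); last first.
    by apply/funext => N; rewrite mulrS opprD.
  rewrite -[X in is_lub _ X](addr0 0).
  by apply: is_lubD => //; apply: nondec_step => N; rewrite po_leN//; exact: po_leMn.
have ap N : f t - e N <= box f (a N) t <= f t + e N.
  have := @mixed_diff_approx (enum 'I_n) (a N) t t f fge0 fm (enum_uniq _) (fun _ _ => erefl).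
  by under eq_bigr do rewrite mxE.
split=> [N|y hy].
  rewrite -(po_suble0 po) -(po_oppr_ge0 po); apply: e0.2 => M.
  apply: (le_trans (nde _ _ (leq_maxr N M))); rewrite po_leN// (po_leBlDr po) addrC.
  have /andP[_] := ap (maxn N M); apply: le_trans; apply: box_mono => // i.
  by rewrite !mxE lerN2 ler_nat leq_maxl.
rewrite -(po_subge0 po); apply: e0.2 => N; rewrite (po_leBrDr po) addrC.
by have /andP[h _] := ap N; exact: le_trans h (hy N).
Qed.

End Distribution.
End Boxes.

(** * Borel sets of R^n *)

Lemma bigcup_unpickle (S : Type) (T : countType) (P : set T) (A : T -> set S) :
  \bigcup_(t in P) A t = \bigcup_k
    (if (unpickle k : option T) is Some t then [set x | P t /\ A t x] else set0).
Proof.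
apply/seteqP; split=> [x [t Pt Atx]|x [k _]].
  by exists (pickle t) => //; rewrite pickleK.
by case: (unpickle k) => // t [Pt Atx]; exists t.
Qed.

Lemma g_sigma_countable_bigcup (S : Type) (C : set (set S)) (T : countType)
    (P : set T) (A : T -> set S) :
  (forall t, P t -> <<s C >> (A t)) -> <<s C >> (\bigcup_(t in P) A t).
Proof.
move=> mA; rewrite bigcup_unpickle; apply: g_sigma_bigcup => k.
case: (unpickle k) => [t|]; last exact: g_sigma_set0.
have [Pt|nPt] := pselect (P t).
  rewrite (_ : [set x | _] = A t); first exact: mA.
  by apply/seteqP; split=> [x []|x].
rewrite (_ : [set x | _] = set0); first exact: g_sigma_set0.
by apply/seteqP; split=> [x []|x].
Qed.

Lemma g_sigma_countable_bigcap (S : Type) (C : set (set S)) (T : countType)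
    (P : set T) (A : T -> set S) :
  (forall t, P t -> <<s C >> (A t)) -> <<s C >> (\bigcap_(t in P) A t).
Proof.
move=> mA; rewrite -(setCK (\bigcap_(t in P) A t)) setC_bigcap.
exact: (g_sigma_setC (g_sigma_countable_bigcup (fun t Pt => g_sigma_setC (mA t Pt)))).
Qed.

Section BorelRn.
Variables (R : realType) (n : nat).
Implicit Types (s t x : 'rV[R]_n) (i : 'I_n).

Definition orthants : set (set 'rV[R]_n) := [set lower_orthant t | t in setT].

Lemma orthants_setI : setI_closed orthants.
Proof.
move=> _ _ [s _ <-] [t _ <-]; exists (\row_i Num.min (s 0 i) (t 0 i)) => //.
apply/seteqP; split=> x /=; rewrite /lower_orthant /strictly_below /=.
  by move=> h; split=> i; have := h i; rewrite mxE lt_min => /andP[].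
by move=> [h1 h2] i; rewrite mxE lt_min h1 h2.
Qed.

Lemma nat_coord_bound t : exists N : nat, forall i, `|t 0 i| <= N%:R.
Proof.
pose g i := Num.bound `|t 0 i|.
exists (\max_i g i)%N => i; apply: (@le_trans _ _ (g i)%:R).
  exact/ltW/archi_boundP.
by rewrite ler_nat; exact: leq_bigmax.
Qed.

Lemma half_space_g_sigma i (a : R) : <<s orthants >> [set x : 'rV[R]_n | x 0 i < a].
Proof.
rewrite (_ : [set x | _] = \bigcup_(N : nat) lower_orthant (set_coord (\row__ N%:R) i a)).
  apply: g_sigma_bigcup => N; apply: sub_sigma_algebra; by exists (set_coord (\row__ N%:R) i a).
apply/seteqP; split=> [x /= xa|x [N _ /(_ i)]]; last by rewrite set_coordE eqxx.
have [N hN] := nat_coord_bound x; exists N.+1 => // j; rewrite set_coordE.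
case: eqP => [->//|_]; rewrite mxE; apply: (le_lt_trans (ler_norm _)).
by apply: (le_lt_trans (hN j)); rewrite ltr_nat.
Qed.

Lemma open_lower_orthant t : open (lower_orthant t).
Proof.
rewrite openE => x xt.
have : nbhs x (fun y : 'rV[R]_n => forall i, y 0 i < t 0 i); last by [].
apply: (@filter_forall _ _ (fun i (y : 'rV[R]_n) => y 0 i < t 0 i) _ (nbhs_filter x)) => i.
apply: (@coord_continuous R 1 n 0 i x [set z | z < t 0 i]).
apply: open_nbhs_nbhs; split; [exact: open_lt|exact: xt].
Qed.

Lemma borel_lower_orthant t : borel_Rn (lower_orthant t).
Proof. by apply: sub_sigma_algebra; exact: open_lower_orthant. Qed.

(** An open set is the countable union of the rational cells inside it. The cells are half-open
    because differences of the half-spaces [x 0 i < a] have this shape. *)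
Lemma borel_Rn_orthants : @borel_Rn R n = <<s orthants >>.
Proof.
apply/seteqP; split; apply: smallest_sub.
- exact: smallest_sigma_algebra.
- move=> U oU.
  pose cell (q : 'rV[rat]_n * 'rV[rat]_n) : set 'rV[R]_n :=
    [set x | forall i, ratr (q.1 0 i) <= x 0 i < ratr (q.2 0 i)].
  rewrite (_ : U = \bigcup_(q in [set q | cell q `<=` U]) cell q).
    apply: g_sigma_countable_bigcup => q _.
    rewrite (_ : cell q = \bigcap_(i in [set: 'I_n])
      ([set x | x 0 i < ratr (q.2 0 i)] `\` [set x | x 0 i < ratr (q.1 0 i)])).
      by apply: g_sigma_countable_bigcap => i _; apply: g_sigma_setD; exact: half_space_g_sigma.
    apply/seteqP; split=> [x h i _|x h i]; have := h i; rewrite /= ?leNgt.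
      by move=> /andP[/negP].
    by move=> /(_ I)[-> /negP ->].
  apply/seteqP; split=> [x Ux|x [q] /=]; last by move=> h /h.
  have : nbhs x U by exact: open_nbhs_nbhs.
  move=> /nbhs_ballP[e /= e0 xe].
  have /choice[a aP] i : exists q : rat, x 0 i - e < ratr q < x 0 i.
    have /rat_in_itvoo[q] : x 0 i - e < x 0 i by rewrite ltrBlDr ltrDl.
    by rewrite in_itv; exists q.
  have /choice[b bP] i : exists q : rat, x 0 i < ratr q < x 0 i + e.
    have /rat_in_itvoo[q] : x 0 i < x 0 i + e by rewrite ltrDl.
    by rewrite in_itv; exists q.
  exists (\row_i a i, \row_i b i) => [y hy|i] /=; last first.
    by rewrite !mxE; have /andP[_ /ltW ->] := aP i; have /andP[-> _] := bP i.
  apply: xe; split=> // i j; rewrite ord1; have := hy j; rewrite !mxE => /andP[h1 h2].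
  have /andP[h3 _] := aP j; have /andP[_ h4] := bP j.
  by rewrite /ball /= ltr_norml; apply/andP; split; lra.
- exact: smallest_sigma_algebra.
- by move=> _ [t _ <-]; apply: sub_sigma_algebra; exact: open_lower_orthant.
Qed.

End BorelRn.

(** * From distribution functions to measures *)

Section RnExtension.
Variables (R : realType) (n : nat) (i0 : 'I_n).
Implicit Types (a b t : 'rV[R]_n) (i : 'I_n) (q : rat) (s : seq bool).

(** Numbers rejected by [unpickle] repeat the question whether coordinate [i0] is below [0]; points
    are read off from the bits [code i q] only. *)
Definition generator (k : nat) : 'I_n * rat := odflt (i0, 0) (unpickle k).

(* Bit [code i q] of the coding of a point [x] is the truth value of [x 0 i < ratr q]. *)
Definition code i q : nat := pickle (i, q).

Lemma generatorK i q : generator (code i q) = (i, q).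
Proof. by rewrite /generator /code pickleK. Qed.

(** Together with [upper_corner], this bounds the half-open box of points whose answers to the first
    questions are [s]: a negative answer raises a lower face, a positive one lowers an upper
    face. *)
Fixpoint lower_corner a s : 'rV[R]_n :=
  if s is b :: s' then
    if b then lower_corner a s'
    else set_coord (lower_corner a s') (generator (size s')).1
      (Num.max (lower_corner a s' 0 (generator (size s')).1) (ratr (generator (size s')).2))
  else a.

Fixpoint upper_corner a s : 'rV[R]_n :=
  if s is b :: s' then
    if b then set_coord (upper_corner a s') (generator (size s')).1
      (Num.min (upper_corner a s' 0 (generator (size s')).1) (ratr (generator (size s')).2))
    else upper_corner a s'
  else a.

Lemma lower_corner_le a b s : le_coord a b -> le_coord (lower_corner a s) (lower_corner b s).
Proof.
move=> ab; elim: s => //= -[] s IH //; apply: le_set_coord => //.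
by rewrite ge_max !le_max IH /= lexx orbT.
Qed.

Lemma upper_corner_le a b s : le_coord a b -> le_coord (upper_corner a s) (upper_corner b s).
Proof.
move=> ab; elim: s => //= -[] s IH //; apply: le_set_coord => //.
by rewrite le_min !ge_min IH /= lexx orbT.
Qed.

Lemma upper_corner_min a b s : upper_corner (\row_i Num.min (a 0 i) (b 0 i)) s =
  \row_i Num.min (upper_corner a s 0 i) (b 0 i).
Proof.
elim: s => //= -[] s IH //; apply/rowP => j; rewrite set_coordE !IH !mxE.
by case: eqP => [->|//]; rewrite minAC.
Qed.

Lemma cylinder_bit s c c' k : cylinder s c -> cylinder s c' -> (k < size s)%N -> c k = c' k.
Proof.
elim: s => //= b s IH; rewrite cylinder_cons => -[sc cb] [sc' cb'].
by rewrite ltnS leq_eqVlt => /orP[/eqP->|/IH]; [rewrite cb cb'|apply].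
Qed.

Lemma upper_corner_bit s c i q a : cylinder s c -> (code i q < size s)%N -> c (code i q) ->
  upper_corner a s 0 i <= ratr q.
Proof.
elim: s => //= b s IH; rewrite cylinder_cons => -[sc /= cb].
rewrite ltnS leq_eqVlt => /orP[/eqP k|ks] ck.
  by rewrite -cb -k ck generatorK set_coordE eqxx ge_min lexx orbT.
have {}IH := IH sc ks ck; case: b cb => _ //; rewrite set_coordE; case: eqP => [<-|//].
by rewrite ge_min IH.
Qed.

Lemma lower_corner_bit s c i q a : cylinder s c -> (code i q < size s)%N -> ~~ c (code i q) ->
  ratr q <= lower_corner a s 0 i.
Proof.
elim: s => //= b s IH; rewrite cylinder_cons => -[sc /= cb].
rewrite ltnS leq_eqVlt => /orP[/eqP k|ks] ck.
  by rewrite -cb -k (negbTE ck) generatorK set_coordE eqxx le_max lexx orbT.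
have {}IH := IH sc ks ck; case: b cb => _ //; rewrite set_coordE; case: eqP => [<-|//].
by rewrite le_max IH.
Qed.

Lemma prefix_rev_eq c c' k : (forall j, (j < k)%N -> c j = c' j) ->
  prefix_rev c k = prefix_rev c' k.
Proof.
elim: k => //= k IH h; rewrite h// IH// => j jk; apply: h; exact: leqW.
Qed.

Lemma cylinder_nonempty s : exists c, cylinder s c.
Proof.
elim: s => [|b s [c sc]]; first by exists (fun=> false).
exists (fun k => if k == size s then b else c k); rewrite cylinder_cons; split; last by rewrite /= eqxx.
rewrite /cylinder /= -[RHS]sc; apply: prefix_rev_eq => j js.
by rewrite (ltn_eqF js).
Qed.

Variables (G : porderZmodType) (po : po_group G).
Hypotheses (dir : directed_group G) (ic : integrally_closed G).
Hypothesis sc : monotone_sigma_complete G.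
Variables (f : 'rV[R]_n -> G) (u : G).
Hypothesis fd : distribution f.
Hypothesis f_top : is_lub (fun N : nat => f (\row__ N%:R)) u.
Hypothesis f_left : forall t, is_lub (fun k : nat => f (\row_i (t 0 i - k.+1%:R^-1))) (f t).

Let fbox := dist_box fd.

Lemma box_le_total a b : box f a b <= u.
Proof.
have [N hN] := nat_coord_bound a; have [M hM] := nat_coord_bound b.
apply: (@le_trans _ _ (box f (\row__ (- N%:R)) b)).
  apply: box_mono => // i; rewrite mxE; have := hN i; rewrite ler_norml => /andP[].
  by [].
apply: le_trans ((box_lub po b fd).1 N) _; apply: le_trans (f_top.1 M).
by apply: (dist_mono fd) => i; rewrite mxE; apply: le_trans (hM i); exact: ler_norm.
Qed.

Definition nondec_coord (h : nat -> 'rV[R]_n) : Prop := forall N, le_coord (h N) (h N.+1).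

(** The window grows to minus infinity below and along [h] above. With [cube] for [h] the limit is
    the mass of a whole cell, with [clipped_cube] that of its part below a point. *)
Definition cell_box (h : nat -> 'rV[R]_n) s (N : nat) : G :=
  box f (lower_corner (\row__ (- N%:R)) s) (upper_corner (h N) s).

Definition mass h s : G := xget 0 [set g | is_lub (cell_box h s) g].

Lemma nondec_cell_box h s : nondec_coord h -> nondec (cell_box h s).
Proof.
move=> hh; apply: nondec_step => N; apply: box_mono => //.
- by apply: lower_corner_le => i; rewrite !mxE lerN2 ler_nat.
- exact: upper_corner_le.
Qed.

Lemma mass_lub h s : nondec_coord h -> is_lub (cell_box h s) (mass h s).
Proof.
move=> hh; have [|g hg] := nondec_lub sc (nondec_cell_box s hh) (b := u).
  by move=> N; exact: box_le_total.
by apply: (@xgetPex _ 0 [set g | is_lub (cell_box h s) g]); exists g.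
Qed.

Lemma mass_ge0 h s : nondec_coord h -> 0 <= mass h s.
Proof. by move=> /(mass_lub s)[/(_ 0%N) h0 _]; exact: le_trans (fbox _ _) h0. Qed.

Lemma massD h s : nondec_coord h -> mass h s = mass h (true :: s) + mass h (false :: s).
Proof.
move=> hh; apply: is_lub_unique (mass_lub s hh) _.
rewrite (_ : cell_box h s = fun N => cell_box h (true :: s) N + cell_box h (false :: s) N).
  apply: is_lubD => //; [exact: nondec_cell_box|exact: nondec_cell_box| |];
  exact: mass_lub.
by apply/funext => N; rewrite /cell_box /=; exact: box_split.
Qed.

Lemma mass_eq h h' s : cell_box h s = cell_box h' s -> mass h s = mass h' s.
Proof. by rewrite /mass => ->. Qed.

Lemma mass_empty h s : (exists i, forall N,
    upper_corner (h N) s 0 i <= lower_corner (\row__ (- N%:R)) s 0 i) ->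
  nondec_coord h -> mass h s = 0.
Proof.
move=> [i hi] /(mass_lub s) h1; apply: is_lub_unique h1 _.
rewrite (_ : cell_box h s = fun=> 0); first exact: is_lub_const.
by apply/funext => N; exact: box_empty (hi N).
Qed.

Definition cube (N : nat) : 'rV[R]_n := \row__ N%:R.

Lemma nondec_cube : nondec_coord cube.
Proof. by move=> N i; rewrite !mxE ler_nat. Qed.

Definition clipped_cube t (N : nat) : 'rV[R]_n := \row_i Num.min (cube N 0 i) (t 0 i).

Lemma nondec_clipped_cube t : nondec_coord (clipped_cube t).
Proof.
move=> N i; rewrite [X in X <= _]mxE [X in _ <= X]mxE le_min !ge_min (nondec_cube N i) /=.
by rewrite lexx orbT.
Qed.

Lemma mass_cube_nil : mass cube [::] = u.
Proof.
apply: is_lub_unique (mass_lub [::] nondec_cube) _; split=> [N|y hy]; first exact: box_le_total.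
apply: f_top.2 => M; apply: (box_lub po (cube M) fd).2 => N.
apply: le_trans (hy (maxn N M)); apply: box_mono => // i; rewrite /= !mxE.
- by rewrite lerN2 ler_nat leq_maxl.
- by rewrite ler_nat leq_maxr.
Qed.

Lemma mass_clipped_nil t : mass (clipped_cube t) [::] = f t.
Proof.
apply: is_lub_unique (mass_lub [::] (@nondec_clipped_cube t)) _.
have [M hM] := nat_coord_bound t.
apply: (@is_lub_eventually _ (fun N : nat => box f (\row__ (- N%:R)) t) _ _ M _ _ _ (box_lub po t fd)).
- apply: nondec_step => N; apply: box_mono => // i.
  by rewrite !mxE lerN2 ler_nat.
- exact: nondec_cell_box (@nondec_clipped_cube t).
- move=> N MN; rewrite /cell_box /=; congr box; apply/rowP => i; rewrite !mxE.
  apply/esym/min_idPr; apply: le_trans (ler_norm _) _; apply: le_trans (hM i) _.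
  by rewrite ler_nat.
Qed.

(** * From codes to points: almost every code is a cut *)

Section Measure.
Variable nu : set (nat -> bool) -> G.
Hypothesis nu_ge0 : forall A, cantor_borel A -> 0 <= nu A.
Hypothesis nuU : forall A B, cantor_borel A -> cantor_borel B -> A `&` B = set0 ->
  nu (A `|` B) = nu A + nu B.
Hypothesis nu_lub : forall A : nat -> set (nat -> bool), (forall k, cantor_borel (A k)) ->
  (forall k, A k `<=` A k.+1) -> is_lub (fun k => nu (A k)) (nu (\bigcup_k A k)).
Hypothesis nu_cylinder : forall s, nu (cylinder s) = mass cube s.

Lemma nu0 : nu set0 = 0.
Proof.
have := nuU (@g_sigma_set0 _ _) (@g_sigma_set0 _ _) (setI0 set0).
by rewrite setU0 => E; apply: (addrI (nu set0)); rewrite addr0 -E.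
Qed.

Lemma nuD A B : cantor_borel A -> cantor_borel B -> nu A = nu (A `&` B) + nu (A `\` B).
Proof.
move=> mA mB; rewrite -nuU ?setUIDK//.
- exact: g_sigma_setI.
- exact: g_sigma_setD.
- by apply/seteqP; split=> // c [[_ Bc] [_]].
Qed.

Lemma nu_le A B : cantor_borel A -> cantor_borel B -> A `<=` B -> nu A <= nu B.
Proof.
move=> mA mB AB; rewrite (nuD mB mA) (setIidr AB) po_lerDl//.
by apply: nu_ge0; exact: g_sigma_setD.
Qed.

Lemma nu_leU A B : cantor_borel A -> cantor_borel B -> nu (A `|` B) <= nu A + nu B.
Proof.
move=> mA mB; have mU := g_sigma_setU mA mB; rewrite (nuD mU mA) setUK (po_leDl po).
apply: nu_le => //; first exact: g_sigma_setD.
by move=> c [[|]].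
Qed.

Lemma nu_setT : nu setT = u.
Proof. by rewrite -cylinder_nil nu_cylinder mass_cube_nil. Qed.

Lemma cylinder_measurable s : cantor_borel (cylinder s).
Proof. by apply: sub_sigma_algebra; right; exists s. Qed.

(** Additivity over the two extensions of a string carries the agreement at length [K] back to the
    root. *)
Lemma nu_tree X (mX : seq bool -> G) K : cantor_borel X ->
  (forall s, mX s = mX (true :: s) + mX (false :: s)) ->
  (forall s, size s = K -> nu (cylinder s `&` X) = mX s) -> nu X = mX [::].
Proof.
move=> mbX mXD hK.
suff H d s : (size s + d = K)%N -> nu (cylinder s `&` X) = mX s.
  by have := H K [::] (add0n K); rewrite cylinder_nil setTI.
elim: d s => [|d IH] s; first by rewrite addn0; exact: hK.
rewrite addnS => sK; rewrite mXD -!IH ?addSn//.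
rewrite -nuU.
- congr nu; rewrite -setIUl !cylinder_cons -setIUr (_ : _ `|` _ = setT) ?setIT//.
  by apply/seteqP; split=> // c _ /=; case: (c _); [left|right].
- by apply: g_sigma_setI => //; exact: cylinder_measurable.
- by apply: g_sigma_setI => //; exact: cylinder_measurable.
- apply/seteqP; split=> // c [[]]; rewrite !cylinder_cons => -[_ /= h] _ [[_ /=]].
  by rewrite h.
Qed.

Definition bit_set i q : set (nat -> bool) := [set c | c (code i q)].

Lemma bit_set_measurable i q : cantor_borel (bit_set i q).
Proof.
rewrite (_ : bit_set i q = \bigcup_(s in [set s : seq bool | cylinder s `<=` bit_set i q]) cylinder s).
  by apply: g_sigma_countable_bigcup => s _; exact: cylinder_measurable.
apply/seteqP; split=> [c ci|c [s /= h]]; last exact: h.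
have cs : cylinder (prefix_rev c (code i q).+1) c by rewrite /cylinder /= size_prefix_rev.
exists (prefix_rev c (code i q).+1) => // c' cs'.
by rewrite /bit_set /= -(cylinder_bit cs cs') // size_prefix_rev.
Qed.

Definition orthant_bits (q : 'I_n -> rat) : set (nat -> bool) := [set c | forall i, c (code i (q i))].

Lemma orthant_bits_measurable (q : 'I_n -> rat) : cantor_borel (orthant_bits q).
Proof.
rewrite (_ : orthant_bits q = \bigcap_(i in [set: 'I_n]) bit_set i (q i)).
  by apply: g_sigma_countable_bigcap => i _; exact: bit_set_measurable.
by apply/seteqP; split=> [c h i _|c h i]; exact: h.
Qed.

(** A string long enough to answer all the questions [x 0 i < ratr (q i)] has a cell that either
    lies below [t], where clipping changes nothing, or becomes empty when clipped. So the measure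
    agrees with the clipped mass. *)
Lemma nu_orthant_bits (q : 'I_n -> rat) : nu (orthant_bits q) = f (\row_i ratr (q i)).
Proof.
set t : 'rV[R]_n := \row_i ratr (q i).
rewrite -(mass_clipped_nil t); pose K := (\max_i code i (q i)).+1.
have codeK i : (code i (q i) < K)%N by rewrite ltnS; exact: (leq_bigmax (F := fun i => code i (q i))).
apply: (nu_tree (K := K) (orthant_bits_measurable q)) => [s|s sK].
  exact: massD (@nondec_clipped_cube t).
have [c sc'] := cylinder_nonempty s.
have uE N : upper_corner (clipped_cube t N) s = \row_i Num.min (upper_corner (cube N) s 0 i) (t 0 i).
  exact: upper_corner_min.
have [h|/existsNP[i /negP ci]] := pselect (orthant_bits q c).
  rewrite (_ : _ `&` _ = cylinder s); last first.
    apply/setIidl => c' sc'' i; rewrite -(cylinder_bit sc' sc'') ?sK//; exact: h.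
  rewrite nu_cylinder; apply: mass_eq; apply/funext => N; rewrite /cell_box uE; congr box.
  apply/rowP => i; rewrite [RHS]mxE; apply/esym/min_idPl; rewrite mxE.
  by apply: (upper_corner_bit _ sc'); rewrite ?sK//; exact: h.
rewrite (_ : _ `&` _ = set0) ?nu0; last first.
  apply/seteqP; split=> // c' [sc'' /(_ i)].
  by rewrite -(cylinder_bit sc' sc'') ?sK// (negbTE ci).
apply/esym/mass_empty; last exact: nondec_clipped_cube.
exists i => N; rewrite uE mxE; apply: (@le_trans _ _ (t 0 i)); first by rewrite ge_min lexx orbT.
by rewrite mxE; apply: (lower_corner_bit _ sc'); rewrite ?sK.
Qed.

(** Such contradictory answers leave an empty box: its upper face is at most [q], its lower face at
    least [q']. *)
Lemma nu_bit_monotone i q q' : q <= q' -> nu (bit_set i q `\` bit_set i q') = 0.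
Proof.
move=> qq'; pose K := (maxn (code i q) (code i q')).+1.
have mX : cantor_borel (bit_set i q `\` bit_set i q') by apply: g_sigma_setD; exact: bit_set_measurable.
apply: (nu_tree (mX := fun=> 0) (K := K) mX) => [s|s sK]; first by rewrite addr0.
have k1 : (code i q < size s)%N by rewrite sK ltnS leq_maxl.
have k2 : (code i q' < size s)%N by rewrite sK ltnS leq_maxr.
have [c sc'] := cylinder_nonempty s.
have [[cq /negP cq']|h] := pselect ((bit_set i q `\` bit_set i q') c).
  have s0 : mass cube s = 0.
    apply: mass_empty nondec_cube; exists i => N.
    apply: le_trans (upper_corner_bit _ sc' k1 cq) _.
    by apply: le_trans (lower_corner_bit _ sc' k2 cq'); rewrite ler_rat.
  apply/le_anti/andP; split; last by apply: nu_ge0; apply: g_sigma_setI => //; exact: cylinder_measurable.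
  rewrite -s0 -nu_cylinder; apply: nu_le; last exact: subIsetl.
  - by apply: g_sigma_setI => //; exact: cylinder_measurable.
  - exact: cylinder_measurable.
rewrite (_ : _ `&` _ = set0) ?nu0//; apply/seteqP; split=> // c' [sc'' [c1 c2]].
by apply: h; rewrite /bit_set /= (cylinder_bit sc' sc'' k1) (cylinder_bit sc' sc'' k2).
Qed.

Lemma nu_bigcup_null (A : nat -> set (nat -> bool)) : (forall k, cantor_borel (A k)) ->
  (forall k, nu (A k) = 0) -> nu (\bigcup_k A k) = 0.
Proof.
move=> mA A0; pose C := fix C k := if k is j.+1 then C j `|` A k else A 0%N.
have mC k : cantor_borel (C k).
  by elim: k => [|k IH]; [exact: mA|exact: (g_sigma_setU IH (mA k.+1))].
have C0 k : nu (C k) = 0.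
  elim: k => [|k IH]; first exact: A0.
  apply/le_anti/andP; split; last exact: nu_ge0.
  by apply: le_trans (nu_leU (mC k) (mA k.+1)) _; rewrite IH A0 addr0.
rewrite (_ : \bigcup_k A k = \bigcup_k C k); last first.
  apply/seteqP; split=> c [k _ h].
    by exists k => //; case: k h => //= k h; right.
  elim: k h => [|k IH] /=; first by move=> h; exists 0%N.
  by case=> [/IH//|h]; exists k.+1.
apply: is_lub_unique (nu_lub mC _) _; first by move=> k; exact: subsetUl.
by rewrite (_ : (fun k => nu (C k)) = fun=> 0); [exact: is_lub_const|apply/funext].
Qed.

Lemma nu_countable_bigcup_null (T : countType) (P : set T) (A : T -> set (nat -> bool)) :
  (forall x, P x -> cantor_borel (A x)) -> (forall x, P x -> nu (A x) = 0) ->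
  nu (\bigcup_(x in P) A x) = 0.
Proof.
move=> mA A0.
have E x : P x -> [set z | P x /\ A x z] = A x.
  by move=> Pt; apply/seteqP; split=> [z []|z].
have E0 x : ~ P x -> [set z | P x /\ A x z] = set0.
  by move=> Pt; apply/seteqP; split=> [z []|z].
rewrite bigcup_unpickle; apply: nu_bigcup_null => k; case: (unpickle k) => [x|].
- have [Pt|nPt] := pselect (P x); first by rewrite E//; exact: mA.
  by rewrite E0//; exact: g_sigma_set0.
- exact: g_sigma_set0.
- have [Pt|nPt] := pselect (P x); first by rewrite E//; exact: A0.
  by rewrite E0//; exact: nu0.
- exact: nu0.
Qed.

Lemma row_cube (N : nat) : \row_i ratr (N%:R : rat) = cube N.
Proof. by apply/rowP => i; rewrite !mxE ratr_nat. Qed.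

Lemma nu_outside_cube (N : nat) X : cantor_borel X ->
  nu (X `\` orthant_bits (fun=> N%:R)) <= u - f (cube N).
Proof.
move=> mX; have mE := orthant_bits_measurable (fun=> N%:R).
rewrite -nu_setT (nuD (@g_sigma_setT _ _) mE) setTI nu_orthant_bits row_cube addrC addKr.
apply: nu_le; last by move=> c [].
- exact: (g_sigma_setD mX mE).
- exact: (g_sigma_setD (@g_sigma_setT _ _) mE).
Qed.

Lemma le0_of_top y : (forall N, y <= u - f (cube N)) -> y <= 0.
Proof.
move=> h; rewrite -(po_oppr_ge0 po) -(po_leDl po u) addr0; apply: f_top.2 => N.
by rewrite (po_leBrDr po) addrC -(po_leBrDr po); exact: h.
Qed.

(** These codes place coordinate [i] at plus infinity, outside every cube, and the measure outside
    the cubes decreases to [0]. *)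
Lemma nu_no_bits i : nu (\bigcap_(q in [set: rat]) ~` bit_set i q) = 0.
Proof.
set X := \bigcap_(_ in _) _.
have mX : cantor_borel X.
  by apply: g_sigma_countable_bigcap => q _; apply: g_sigma_setC; exact: bit_set_measurable.
apply/le_anti/andP; split; last exact: nu_ge0.
apply: le0_of_top => N; apply: le_trans (nu_outside_cube N mX).
rewrite (_ : X `\` _ = X)//; apply/seteqP; split=> [c []//|c Xc]; split=> // h.
exact: (Xc N%:R I (h i)).
Qed.

(** These codes place coordinate [i] at minus infinity. Inside a fixed cube their measure is below
    values of [f] that decrease to [0]; the part outside is small with the cube. *)
Lemma nu_all_bits i : nu (\bigcap_(q in [set: rat]) bit_set i q) = 0.
Proof.
set X := \bigcap_(_ in _) _.
have mX : cantor_borel X by apply: g_sigma_countable_bigcap => q _; exact: bit_set_measurable.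
apply/le_anti/andP; split; last exact: nu_ge0.
apply: le0_of_top => N; have mE := orthant_bits_measurable (fun=> N%:R).
have mXE := g_sigma_setI mX mE.
rewrite (nuD mX mE) -[leRHS]add0r; apply: (po_leD po); last exact: nu_outside_cube.
rewrite -(po_oppr_ge0 po); apply: (dist_bottom fd i (cube N)).2 => M; rewrite (po_leN po).
pose q (j : 'I_n) : rat := if j == i then - M%:R else N%:R.
have -> : set_coord (cube N) i (- M%:R) = \row_j ratr (q j).
  apply/rowP => j; rewrite set_coordE !mxE /q; case: eqP => _; last by rewrite ratr_nat.
  by rewrite rmorphN /= ratr_nat.
rewrite -nu_orthant_bits; apply: nu_le => //; first exact: orthant_bits_measurable.
by move=> c [Xc Ec] j; rewrite /q; case: eqP => [->|_]; [exact: Xc|exact: Ec].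
Qed.

(** The positive answers about a coordinate form a proper nonempty upper set of rationals, hence
    determine a real number; the answer at the number itself, if rational, may be either. *)
Definition cuts : set (nat -> bool) :=
  [set c : nat -> bool | [/\ forall i q q', q <= q' -> c (code i q) -> c (code i q'),
     forall i, exists q, c (code i q) & forall i, exists q, ~~ c (code i q)]].

Let bad_order : set (nat -> bool) :=
  \bigcup_(x in [set x : 'I_n * (rat * rat) | x.2.1 <= x.2.2])
    (bit_set x.1 x.2.1 `\` bit_set x.1 x.2.2).
Let bad_top : set (nat -> bool) :=
  \bigcup_(i in [set: 'I_n]) \bigcap_(q in [set: rat]) ~` bit_set i q.
Let bad_bottom : set (nat -> bool) :=
  \bigcup_(i in [set: 'I_n]) \bigcap_(q in [set: rat]) bit_set i q.

Let bad_order_null : cantor_borel bad_order /\ nu bad_order = 0.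
Proof.
have m (x : 'I_n * (rat * rat)) : cantor_borel (bit_set x.1 x.2.1 `\` bit_set x.1 x.2.2).
  by apply: g_sigma_setD; exact: bit_set_measurable.
split; first by apply: g_sigma_countable_bigcup => x _; exact: m.
by apply: nu_countable_bigcup_null => x h; [exact: m|exact: nu_bit_monotone].
Qed.

Let bad_top_null : cantor_borel bad_top /\ nu bad_top = 0.
Proof.
have m i : cantor_borel (\bigcap_(q in [set: rat]) ~` bit_set i q).
  by apply: g_sigma_countable_bigcap => q _; apply: g_sigma_setC; exact: bit_set_measurable.
split; first by apply: g_sigma_countable_bigcup => i _; exact: m.
by apply: nu_countable_bigcup_null => i _; [exact: m|exact: nu_no_bits].
Qed.

Let bad_bottom_null : cantor_borel bad_bottom /\ nu bad_bottom = 0.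
Proof.
have m i : cantor_borel (\bigcap_(q in [set: rat]) bit_set i q).
  by apply: g_sigma_countable_bigcap => q _; exact: bit_set_measurable.
split; first by apply: g_sigma_countable_bigcup => i _; exact: m.
by apply: nu_countable_bigcup_null => i _; [exact: m|exact: nu_all_bits].
Qed.

Let cutsE : cuts = ~` (bad_order `|` bad_top `|` bad_bottom).
Proof.
apply/seteqP; split=> c.
  move=> [h1 h2 h3] [[|]|].
  - by move=> [[i [q q']] /= qq' [cq]]; apply; exact: h1 cq.
  - by move=> [i _ h]; have [q cq] := h2 i; exact: (h q I).
  - by move=> [i _ h]; have [q /negP cq] := h3 i; exact/cq/(h q I).
move=> h; split=> [i q q' qq' cq|i|i].
- apply: contrapT => cq'; apply: h; left; left; by exists (i, (q, q')).
- apply: contrapT => /forallNP hi; apply: h; left; right; by exists i => // q _; exact: hi.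
- apply: contrapT => /forallNP hi; apply: h; right; exists i => // q _.
  by have /negP := hi q; rewrite negbK.
Qed.

Lemma cuts_measurable : cantor_borel cuts.
Proof.
rewrite cutsE.
exact: (g_sigma_setC (g_sigma_setU (g_sigma_setU bad_order_null.1 bad_top_null.1) bad_bottom_null.1)).
Qed.

Lemma nu_cuts A : cantor_borel A -> nu (cuts `&` A) = nu A.
Proof.
move=> mA; rewrite [RHS](nuD mA cuts_measurable) setIC -[LHS]addr0; congr (_ + _).
apply/le_anti/andP; split; first by apply: nu_ge0; exact: (g_sigma_setD mA cuts_measurable).
have [m1 n1] := bad_order_null; have [m2 n2] := bad_top_null; have [m3 n3] := bad_bottom_null.
have m12 := g_sigma_setU m1 m2.
apply: (@le_trans _ _ (nu (bad_order `|` bad_top `|` bad_bottom))).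
  apply: nu_le; [exact: (g_sigma_setD mA cuts_measurable)|exact: (g_sigma_setU m12 m3)|].
  by rewrite cutsE setDE setCK; exact: subIsetr.
apply: le_trans (nu_leU m12 m3) _; rewrite n3 addr0.
by apply: le_trans (nu_leU m1 m2) _; rewrite n1 n2 addr0.
Qed.

Definition cut_point (c : nat -> bool) : 'rV[R]_n :=
  \row_i inf [set ratr q | q in [set q | c (code i q)]].

Lemma cut_point_lt c i (x : R) : cuts c ->
  cut_point c 0 i < x <-> exists2 q, c (code i q) & ratr q < x.
Proof.
move=> [h1 h2 h3]; rewrite mxE; set S := [set _ | _ in _].
have hS : has_inf S.
  split; first by have [q cq] := h2 i; exists (ratr q), q.
  have [q0 /negP cq0] := h3 i; exists (ratr q0) => _ [q cq <-].
  rewrite ler_rat leNgt; apply/negP => qq0; apply: cq0; exact: h1 (ltW qq0) cq.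
split=> [Sx|[q cq qx]].
  have e0 : 0 < x - inf S by rewrite subr_gt0.
  have [_ [q cq <-]] := inf_adherent e0 hS; rewrite addrC subrK => qx.
  by exists q.
apply: le_lt_trans qx; apply: (ge_inf hS.2); by exists q.
Qed.

(** Because the answer at a rational equal to the coordinate is ambiguous, the orthant is described
    by rationals strictly below [t] that increase to it. *)
Lemma cut_point_orthant t :
  exists r : nat -> 'I_n -> rat,
    [/\ forall k i, t 0 i - k.+1%:R^-1 < ratr (r k i),
        forall k i, ratr (r k i) < t 0 i &
        (forall k, cuts `&` orthant_bits (r k) `<=` cuts `&` orthant_bits (r k.+1)) /\
        cuts `&` cut_point @^-1` lower_orthant t = \bigcup_k (cuts `&` orthant_bits (r k))].
Proof.
(* Successive choices lie in adjacent intervals, so they increase with [k]. *)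
have /choice[r rP] (x : nat * 'I_n) :
    exists q : rat, t 0 x.2 - x.1.+1%:R^-1 < ratr q < t 0 x.2 - x.1.+2%:R^-1.
  have /rat_in_itvoo[q] : t 0 x.2 - x.1.+1%:R^-1 < t 0 x.2 - x.1.+2%:R^-1.
    by rewrite ltrD2l ltrN2 ltf_pV2 ?posrE ?ltr0Sn// ltr_nat.
  by rewrite in_itv; exists q.
exists (fun k i => r (k, i)).
have r1 k i : t 0 i - k.+1%:R^-1 < ratr (r (k, i)) by have /andP[] := rP (k, i).
have r2 k i : ratr (r (k, i)) < t 0 i - k.+2%:R^-1 by have /andP[] := rP (k, i).
have r3 k i : ratr (r (k, i)) < t 0 i.
  by apply: lt_trans (r2 k i) _; rewrite ltrBlDr ltrDl invr_gt0 ltr0Sn.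
have mono k : cuts `&` orthant_bits (fun i => r (k, i)) `<=`
    cuts `&` orthant_bits (fun i => r (k.+1, i)).
  move=> c [cc h]; split=> // i; have [h1 _ _] := cc; apply: h1 (h i).
  by rewrite -(ler_rat R) ltW// (lt_trans (r2 k i)).
split=> //; split=> //; apply/seteqP; split=> c.
  move=> [cc ct].
  have /choice[q qP] i : exists q, c (code i q) /\ ratr q < t 0 i.
    by have [q] := (cut_point_lt i (t 0 i) cc).1 (ct i); exists q.
  have /choice[K KP] i : exists K : nat, ratr (q i) <= t 0 i - K.+1%:R^-1.
    have ti : 0 < t 0 i - ratr (q i) by rewrite subr_gt0; case: (qP i).
    exists (Num.bound (t 0 i - ratr (q i))^-1).
    rewrite lerBrDr -lerBrDl -[leRHS]invrK lef_pV2 ?posrE ?invr_gt0//.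
    have ti' : 0 <= (t 0 i - ratr (q i))^-1 by rewrite invr_ge0 ltW.
    by apply: le_trans (ltW (archi_boundP ti')) _; rewrite ler_nat.
  exists (\max_i K i)%N => //; split=> // i; have [h1 _ _] := cc.
  apply: h1 (qP i).1; rewrite -(ler_rat R); apply: le_trans (KP i) _.
  apply: le_trans (ltW (r1 _ i)); rewrite lerD2l lerN2 lef_pV2 ?posrE ?ltr0Sn// ler_nat ltnS.
  exact: leq_bigmax.
move=> [k _ [cc h]]; split=> // i; apply/(cut_point_lt i (t 0 i) cc).
by exists (r (k, i)).
Qed.

Lemma cut_point_measurable A : borel_Rn A -> cantor_borel (cuts `&` cut_point @^-1` A).
Proof.
rewrite borel_Rn_orthants; pose Q := [set A | cantor_borel (cuts `&` cut_point @^-1` A)].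
suff : <<s @orthants R n >> `<=` Q by apply.
apply: smallest_sub; last first.
  move=> _ [t _ <-]; have [r [_ _ [_]]] := cut_point_orthant t; rewrite /Q /= => ->.
  apply: g_sigma_bigcup => k; apply: g_sigma_setI cuts_measurable _.
  exact: orthant_bits_measurable.
split; rewrite /Q /=.
- by rewrite preimage_set0 setI0; exact: g_sigma_set0.
- move=> B mB; rewrite setTD preimage_setC -setDE.
  rewrite -[X in cantor_borel X]set0U -(setDv cuts) -setDIr.
  exact: (g_sigma_setD cuts_measurable mB).
- move=> B mB; rewrite preimage_bigcup setI_bigcupr; exact: g_sigma_bigcup.
Qed.

Lemma pushforward_measure : exists kappa : set 'rV[R]_n -> G,
  [/\ forall A, borel_Rn A -> 0 <= kappa A,
      kappa setT = u,
      forall A B, borel_Rn A -> borel_Rn B -> A `&` B = set0 ->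
        kappa (A `|` B) = kappa A + kappa B,
      forall A : nat -> set 'rV[R]_n, (forall k, borel_Rn (A k)) ->
        (forall k, A k `<=` A k.+1) -> is_lub (fun k => kappa (A k)) (kappa (\bigcup_k A k)) &
      forall t, kappa (lower_orthant t) = f t].
Proof.
exists (fun A => nu (cuts `&` cut_point @^-1` A)); split.
- by move=> A /cut_point_measurable; exact: nu_ge0.
- by rewrite preimage_setT nu_cuts ?nu_setT//; exact: g_sigma_setT.
- move=> A B mA mB AB; rewrite preimage_setU setIUr nuU//; try exact: cut_point_measurable.
  apply/seteqP; split=> // c [[_ Ac] [_ Bc]].
  by suff : (A `&` B) (cut_point c) by rewrite AB.
- move=> A mA ndA; rewrite preimage_bigcup setI_bigcupr; apply: nu_lub => k.
    exact: cut_point_measurable.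
  by move=> c [cc Ac]; split=> //; exact: ndA.
- move=> t; have [r [r1 r2 [r3 ->]]] := cut_point_orthant t.
  have mr k := orthant_bits_measurable (r k).
  apply: is_lub_unique (nu_lub _ r3) _.
    by move=> k; exact: (g_sigma_setI cuts_measurable (mr k)).
  have E k : nu (cuts `&` orthant_bits (r k)) = f (\row_i ratr (r k i)).
    by rewrite nu_cuts// nu_orthant_bits.
  split=> [k|y hy].
    by rewrite E; apply: (dist_mono fd) => i; rewrite mxE ltW.
  (* Left continuity suffices here, as the [k]-th rational point lies above the [k]-th point of the
     approximation in [f_left]. *)
  apply: (f_left t).2 => k; apply: le_trans (hy k); rewrite E.
  by apply: (dist_mono fd) => i; rewrite !mxE ltW.
Qed.

End Measure.

Lemma measure_of_distribution : exists kappa : set 'rV[R]_n -> G,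
  [/\ forall A, borel_Rn A -> 0 <= kappa A,
      kappa setT = u,
      forall A B, borel_Rn A -> borel_Rn B -> A `&` B = set0 ->
        kappa (A `|` B) = kappa A + kappa B,
      forall A : nat -> set 'rV[R]_n, (forall k, borel_Rn (A k)) ->
        (forall k, A k `<=` A k.+1) -> is_lub (fun k => kappa (A k)) (kappa (\bigcup_k A k)) &
      forall t, kappa (lower_orthant t) = f t].
Proof.
have [nu [h1 h2 h3 h4]] := cantor_extension R po dir ic sc
  (fun s => mass_ge0 s nondec_cube) (fun s => massD s nondec_cube).
exact: pushforward_measure h1 h2 h3 h4.
Qed.

End RnExtension.

(** * Reduction to a distribution function *)

Section Lexicographic.
Variables (G : porderZmodType) (po : po_group G).
Implicit Types (x y : lexZ G) (e : gamma_ea G).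

Lemma lexZ_le x y : (x <= y) = (x.1 <= y.1) && ((y.1 <= x.1) ==> (x.2 <= y.2)).
Proof. by []. Qed.

Lemma lexZ_le_eq x y : x.1 = y.1 -> (x <= y) = (x.2 <= y.2).
Proof. by rewrite lexZ_le => ->; rewrite lexx. Qed.

Lemma lexZ_le_fst x y : x <= y -> x.1 <= y.1.
Proof. by rewrite lexZ_le => /andP[]. Qed.

Lemma lexZ_lt x y : x.1 < y.1 -> x <= y.
Proof. by rewrite lexZ_le => h; rewrite ltW//= leNgt h. Qed.

Lemma lexZ_po : po_group (lexZ G).
Proof.
move=> x y c; rewrite !lexZ_le /= => /andP[h1 h2].
by rewrite !lerD2r (po_leDr po) h1.
Qed.

Lemma int_po : po_group int.
Proof. by move=> x y c; rewrite lerD2r. Qed.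

Definition level e : int := (ea_val e).1.
Definition height e : G := (ea_val e).2.

Lemma level01 e : level e = 0 \/ level e = 1.
Proof.
have /andP[/lexZ_le_fst h1 /lexZ_le_fst h2] := ea_bounds e.
rewrite /level; move: h1 h2 => /=; move: (ea_val e).1 => k.
by rewrite /=; lia.
Qed.

Lemma height_ge0 e : level e = 0 -> 0 <= height e.
Proof. by move=> e0; have /andP[h _] := ea_bounds e; rewrite lexZ_le_eq in h. Qed.

Lemma height_le0 e : level e = 1 -> height e <= 0.
Proof. by move=> e1; have /andP[_ h] := ea_bounds e; rewrite lexZ_le_eq in h. Qed.

Lemma ea_leE e e' : (e <= e') = (ea_val e <= ea_val e').
Proof. by []. Qed.

Lemma ea_le_level e e' : e <= e' -> level e <= level e'.
Proof. by rewrite ea_leE => /lexZ_le_fst. Qed.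

Lemma ea_le_height e e' : level e = level e' -> (e <= e') = (height e <= height e').
Proof. by move=> h; rewrite ea_leE lexZ_le_eq. Qed.

Lemma ea_lt_level e e' : level e = 0 -> level e' = 1 -> e <= e'.
Proof. by move=> h h'; rewrite ea_leE lexZ_lt// -/(level e) h -/(level e') h'. Qed.

Lemma lower_element (h : G) : 0 <= h -> exists e, level e = 0 /\ height e = h.
Proof.
move=> h0; have b : 0 <= lexZ_pair 0 h <= lexZ_unit G.
  by apply/andP; split; [rewrite lexZ_le_eq|exact: lexZ_lt].
by exists (GammaEa b).
Qed.

Lemma upper_element (h : G) : h <= 0 -> exists e, level e = 1 /\ height e = h.
Proof.
move=> h0; have b : 0 <= lexZ_pair 1 h <= lexZ_unit G.
  by apply/andP; split; [exact: lexZ_lt|rewrite lexZ_le_eq].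
by exists (GammaEa b).
Qed.

Lemma element (c : int) (h : G) e e' : level e = c -> level e' = c ->
  height e <= h -> h <= height e' -> exists e'', level e'' = c /\ height e'' = h.
Proof.
move=> <- e'e eh he; case: (level01 e) e'e => E; rewrite E => e'c.
  by apply: lower_element; exact: le_trans (height_ge0 E) eh.
by apply: upper_element; exact: le_trans he (height_le0 e'c).
Qed.

Lemma co_rad_level e : co_rad e -> level e = 1.
Proof. by move=> [g _ E]; rewrite /level E. Qed.

Lemma level_co_rad e : level e = 1 -> co_rad e.
Proof.
move=> e1; exists (- height e); first by rewrite po_oppr_ge0// height_le0.
by rewrite opprK /height /lexZ_pair -e1 /level; case: (ea_val e).
Qed.

Hypothesis sc : monotone_sigma_complete G.

(** The supremum of the heights in [G] lies between two heights of the same level, so it is itself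
    the height of an element of that level, and the two suprema coincide. *)
Lemma ea_sup_height (x : nat -> gamma_ea G) e : (forall k, x k <= x k.+1) ->
  (forall k, level (x k) = level e) -> (forall k, x k <= e) ->
  (forall e', (forall k, x k <= e') -> e <= e') -> is_lub (fun k => height (x k)) (height e).
Proof.
move=> xnd xl xe esup.
have xe' k : height (x k) <= height e by rewrite -ea_le_height.
have nd : nondec (fun k => height (x k)).
  by apply: nondec_step => k; rewrite -ea_le_height// !xl.
have [s hs] := nondec_lub sc nd xe'.
have [e' [le' he']] := element (xl 0%N) erefl (hs.1 0%N) (hs.2 _ xe').
suff <- : s = height e by [].
apply/le_anti/andP; split; first exact: hs.2.
by rewrite -he' -ea_le_height//; apply: esup => k; rewrite ea_le_height ?xl ?he'//; exact: hs.1.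
Qed.

Lemma ea_inf_height (x : nat -> gamma_ea G) : (forall k, x k.+1 <= x k) ->
  (forall k, level (x k) = 0) ->
  (forall e, (forall k, e <= x k) -> e <= ea0 G) -> is_lub (fun k => - height (x k)) 0.
Proof.
move=> xnd xl einf.
have x0 k : 0 <= height (x k) by exact: height_ge0.
have [||s [sx xs]] := noninc_glb po sc (u := fun k => height (x k)) (b := 0).
- by move=> k; rewrite -ea_le_height ?xl.
- exact: x0.
have s0 : 0 <= s by exact: xs.
have [e [le he]] := lower_element s0.
have : e <= ea0 G by apply: einf => k; rewrite ea_le_height ?xl// he.
rewrite ea_le_height// he => s0'; split=> [k|y hy]; first by rewrite po_oppr_le0.
rewrite -(po_oppr_le0 po); apply: le_trans s0'; apply: xs => k.
by rewrite -(po_leN po) opprK.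
Qed.

End Lexicographic.

Section LubShift.
Variables (H : porderZmodType).

Lemma is_lub_shift (v : nat -> H) s m : nondec v -> is_lub (fun k => v (m + k)%N) s -> is_lub v s.
Proof.
move=> nd [vs sv]; split=> [k|y vy].
  by apply: le_trans (vs k); apply: nd; rewrite leq_addl.
by apply: sv => k; exact: vy.
Qed.

End LubShift.

Section Reduction.
Variables (R : realType) (n : nat) (i0 : 'I_n) (G : porderZmodType) (po : po_group G).
Hypotheses (dir : directed_group G) (sc : monotone_sigma_complete G).
Variables (F : 'rV[R]_n -> gamma_ea G) (Fsr : spectral_resolution F).
Implicit Types (a b s t p : 'rV[R]_n) (i : 'I_n).

Let vF : 'rV[R]_n -> lexZ G := @ea_val G \o F.
Let z : 'rV[R]_n -> int := fun t => level (F t).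
Let g : 'rV[R]_n -> G := fun t => height (F t).
Let t0 := characteristic_point F.
Let cube (N : nat) : 'rV[R]_n := \row__ N%:R.
Let low (N : nat) : 'rV[R]_n := \row__ (- N%:R).

Lemma resolution_mono s t : le_coord s t -> F s <= F t.
Proof.
move=> st; have [_ h] := sr_left_continuous Fsr s; apply: h => _ [r rs <-].
have [h _] := sr_left_continuous Fsr t; apply: h; exists r => // i.
exact: lt_le_trans (rs i) (st i).
Qed.

Lemma iter_Delta_mixed_diff (H : 'rV[R]_n -> lexZ G) l a b p : le_coord a b ->
  foldr (fun i K => Delta i (a 0 i) (b 0 i) K) H l p = mixed_diff l a b H p.
Proof.
by move=> ab; elim: l p => //= i l IH p; rewrite /Delta !IH (min_idPl (ab i)).
Qed.

Lemma box_resolution_ge0 a b : 0 <= box vF a b.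
Proof.
rewrite /box mixed_diff_min -iter_Delta_mixed_diff.
  by apply: (sr_volume Fsr) => i; rewrite mxE ge_min lexx orbT.
by move=> i; rewrite mxE ge_min lexx orbT.
Qed.

Lemma box_level a b : (box vF a b).1 = box z a b.
Proof. by rewrite /box (mixed_diff_additive (h := fst)). Qed.

Lemma box_height a b : (box vF a b).2 = box g a b.
Proof. by rewrite /box (mixed_diff_additive (h := snd)). Qed.

Lemma trivial_group (h : G) : (forall k : G, 0 <= k -> k <= 0) -> h = 0.
Proof.
move=> triv; have [c [h0 hc]] := dir h 0.
have c0 : c = 0 by apply/le_anti/andP; split=> //; exact: triv.
apply/le_anti/andP; split; first by rewrite -c0.
rewrite -(po_oppr_le0 po); apply: triv; rewrite po_oppr_ge0//; by rewrite -c0.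
Qed.

(** If the level stayed [1], every (0, k) with [k >= 0] would be a lower bound, so the infimum being
    [0] would make [G] trivial; but then the top would be a lower bound too. *)
Lemma level_bottom i t : exists N : nat, z (set_coord t i (- N%:R)) = 0.
Proof.
have [a za] : exists a : R, z (set_coord t i a) = 0.
  apply: contrapT => /forallNP h.
  have h1 (a : R) : z (set_coord t i a) = 1 by case: (level01 (F (set_coord t i a))) => // /h.
  have [_ inf_h] := sr_bottom Fsr i t.
  have triv (k : G) : 0 <= k -> k <= 0.
    move=> k0; have [e [le he]] := lower_element k0.
    have : e <= ea0 G by apply: inf_h => _ [a _ <-]; apply: ea_lt_level => //; exact: h1.
    by rewrite ea_le_height// he.
  have : ea1 G <= ea0 G.
    apply: inf_h => _ [a _ <-]; rewrite ea_le_height ?[RHS]h1//.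
    by rewrite [X in _ <= X]trivial_group.
  by move/ea_le_level.
exists (Num.bound `|a|); case: (level01 (F (set_coord t i (- (Num.bound `|a|)%:R)))) => // z1.
have : z (set_coord t i (- (Num.bound `|a|)%:R)) <= z (set_coord t i a).
  apply/ea_le_level/resolution_mono/le_set_coord => //; rewrite lerNl.
  by apply: le_trans (ltW (archi_boundP (normr_ge0 a))); rewrite -normrN ler_norm.
by rewrite za /z z1.
Qed.

Lemma level_eventually_bottom i t : exists N, forall M, (N <= M)%N ->
  z (set_coord t i (- M%:R)) = 0.
Proof.
have [N zN] := level_bottom i t; exists N => M NM.
have : z (set_coord t i (- M%:R)) <= z (set_coord t i (- N%:R)).
  by apply/ea_le_level/resolution_mono/le_set_coord => //; rewrite lerN2 ler_nat.
by rewrite zN /z; case: (level01 (F (set_coord t i (- M%:R)))) => ->.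
Qed.

Lemma resolution_bottom_le i t (N : nat) e :
  (forall k, e <= F (set_coord t i (- (N + k)%:R))) -> e <= ea0 G.
Proof.
move=> h; have [_] := sr_bottom Fsr i t; apply => _ [a _ <-].
apply: le_trans (h (Num.bound `|a|)) _; apply: resolution_mono; apply: le_set_coord => //.
rewrite lerNl; apply: (@le_trans _ _ (Num.bound `|a|)%:R); last by rewrite ler_nat leq_addl.
by apply: le_trans (ltW (archi_boundP (normr_ge0 a))); rewrite -normrN ler_norm.
Qed.

Lemma resolution_step_mono i t (k : nat) :
  F (set_coord t i (- k.+1%:R)) <= F (set_coord t i (- k%:R)).
Proof. by apply/resolution_mono/le_set_coord => //; rewrite lerN2 ler_nat. Qed.

Lemma height_bottom i t : exists N : nat, (forall k, z (set_coord t i (- (N + k)%:R)) = 0) /\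
  is_lub (fun k => - g (set_coord t i (- (N + k)%:R))) 0.
Proof.
have [N zN] := level_eventually_bottom i t; exists N.
have zk k : z (set_coord t i (- (N + k)%:R)) = 0 by apply: zN; rewrite leq_addr.
split=> //; apply: (ea_inf_height po sc) => // [k|e he].
  by rewrite addnS; exact: resolution_step_mono.
exact: resolution_bottom_le he.
Qed.

Lemma resolution_distribution : distribution vF.
Proof.
split.
- exact: box_resolution_ge0.
- by move=> t; have /andP[] := ea_bounds (F t).
- by move=> s t /resolution_mono.
- move=> i t; have wpo := lexZ_po po; have [N [zN gN]] := height_bottom i t.
  have nd : nondec (fun k : nat => - vF (set_coord t i (- k%:R))).
    by apply: nondec_step => k; rewrite (po_leN wpo); exact: resolution_step_mono.
  apply: (@is_lub_shift _ _ _ N nd); split=> [k|y hy].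
    by rewrite (po_oppr_le0 wpo); have /andP[] := ea_bounds (F (set_coord t i (- (N + k)%:R))).
  have y1 : 0 <= y.1 by have := lexZ_le_fst (hy 0%N); rewrite /= -/(level _) [level _]zN oppr0.
  have [y0|y0] := eqVneq y.1 0; last by apply: lexZ_lt; rewrite lt_def y0.
  rewrite lexZ_le_eq//; apply: gN.2 => k; have := hy k; rewrite lexZ_le_eq//.
  by rewrite /= -/(level _) [level _]zN oppr0.
Qed.

Lemma level_distribution : distribution z.
Proof.
split.
- by move=> a b; rewrite -box_level; exact: lexZ_le_fst (box_resolution_ge0 a b).
- by move=> t; rewrite /z; case: (level01 (F t)) => ->.
- by move=> s t /resolution_mono/ea_le_level.
- move=> i t; have [N zN] := level_bottom i t; split=> [k|y hy].
    by rewrite oppr_le0 /z; case: (level01 (F (set_coord t i (- k%:R)))) => ->.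
  by have := hy N; rewrite zN oppr0.
Qed.

Let zd := level_distribution.
Let Wd := resolution_distribution.

Lemma level_le1 t : z t <= 1.
Proof. by rewrite /z; case: (level01 (F t)) => ->. Qed.

Lemma box_level_le a b : box z a b <= z b.
Proof.
have [N hN] := nat_coord_bound a.
apply: (@le_trans _ _ (box z (low N) b)); last exact: (box_lub int_po b zd).1.
apply: box_mono => //; [exact: int_po|exact: dist_box zd|move=> i].
by rewrite mxE; have := hN i; rewrite ler_norml => /andP[].
Qed.

(** An integer-valued supremum is attained. *)
Lemma box_level_total t : z t = 1 -> exists N, forall M, (N <= M)%N -> box z (low M) t = 1.
Proof.
move=> zt; have [N hN] : exists N, 1 <= box z (low N) t.
  apply: contrapT => /forallNP h; have [_ /(_ 0)] := box_lub int_po t zd.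
  rewrite zt => /(_ _)/negP[] // => N.
  by have /negP := h N; rewrite -ltNge -[1]add0r ltzD1.
exists N => M NM; apply/le_anti/andP; split.
  by apply: le_trans (box_level_le _ _) _; exact: level_le1.
apply: le_trans hN _; apply: box_mono => //; [exact: int_po|exact: dist_box zd|move=> i].
by rewrite !mxE lerN2 ler_nat.
Qed.

(* The level is a two-valued measure, so it vanishes on every box disjoint from
   an orthant of full level. *)
Lemma box_level_disjoint a b p i : p 0 i <= a 0 i -> z p = 1 -> box z a b = 0.
Proof.
move=> pa /box_level_total[N hN]; have [M hM] := nat_coord_bound a.
set K := maxn N M; pose B : 'rV[R]_n := \row_j Num.max (p 0 j) (b 0 j).
have aK j : (low K) 0 j <= a 0 j.
  rewrite mxE; apply: (@le_trans _ _ (- M%:R)); first by rewrite lerN2 ler_nat leq_maxr.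
  by have := hM j; rewrite ler_norml => /andP[].
have := le_trans (box_level_le (low K) B) (level_le1 B).
rewrite (box_split z (low K) B i (a 0 i)) => h; apply/le_anti/andP; split; last exact: dist_box zd _ _.
have h1 : 1 <= box z (low K) (set_coord B i (Num.min (B 0 i) (a 0 i))).
  rewrite -(hN K (leq_maxl _ _)); apply: box_mono; [exact: int_po|exact: dist_box zd|by move=> j|].
  by move=> j; rewrite set_coordE; case: eqP => [->|_]; rewrite ?le_min !mxE !le_max lexx ?pa.
have h2 : box z a b <= box z (set_coord (low K) i (Num.max ((low K) 0 i) (a 0 i))) B.
  apply: box_mono; [exact: int_po|exact: dist_box zd| |].
    by move=> j; rewrite set_coordE; case: eqP => [->|_]; rewrite ?ge_max ?aK ?lexx.
  by move=> j; rewrite mxE le_max lexx orbT.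
by move: (box z _ _) (box z _ _) (box z _ _) h h1 h2 => *; lia.
Qed.

Lemma level_above_characteristic s : strictly_below t0 s -> z s = 1.
Proof.
move=> ts; have [m [ms _] /co_rad_level m1] := sr_characteristic Fsr.
have : m <= F s by apply: ms; exists s.
by move=> /ea_le_level; rewrite m1 /z; case: (level01 (F s)) => ->.
Qed.

(** Otherwise every element of level [1] bounds the values strictly below [t], and the height of
    [F t] could be lowered by any [k >= 0]. This makes [G] trivial, and then [F t] would be the
    bottom. *)
Lemma level_strictly_below t : z t = 1 -> exists2 s, strictly_below s t & z s = 1.
Proof.
move=> zt; apply: contrapT => h; have [_ Ft] := sr_left_continuous Fsr t.
have s0 s : strictly_below s t -> z s = 0.
  by move=> st; case: (level01 (F s)) => // zs; exfalso; apply: h; exists s.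
have triv (k : G) : 0 <= k -> k <= 0.
  move=> k0; have g0 : g t - k <= 0.
    by rewrite (po_leBlDr po) add0r; apply: le_trans k0; exact: height_le0.
  have [e [le he]] := upper_element g0.
  have : F t <= e by apply: Ft => _ [s st <-]; apply: ea_lt_level => //; exact: s0.
  by rewrite ea_le_height ?le// he (po_leBrDr po) addrC -(po_leBrDr po) subrr.
have : F t <= ea0 G.
  apply: Ft => _ [s st <-]; rewrite ea_le_height ?[LHS]s0//.
  by rewrite [X in X <= _]trivial_group.
by move=> /ea_le_level; rewrite -/(z t) zt.
Qed.

Definition above_point (k : nat) : 'rV[R]_n := \row_i (t0 0 i + k.+1%:R^-1).

Let p := above_point.

Lemma above_point_gt k : strictly_below t0 (p k).
Proof. by move=> i; rewrite [X in _ < X]mxE ltrDl invr_gt0 ltr0Sn. Qed.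

Lemma above_point_mono k : le_coord (p k.+1) (p k).
Proof. by move=> i; rewrite !mxE lerD2l lef_pV2 ?posrE ?ltr0Sn// ler_nat. Qed.

Lemma level_above_point k : z (p k) = 1.
Proof. exact: level_above_characteristic (@above_point_gt k). Qed.

(** Keeps the infimum in [characteristic_point] from being a default value. A point of level [1]
    with coordinate [i] below [- N] would leave level [0] on both sides of the hyperplane at [- N]
    in a box of level [1]. *)
Lemma characteristic_lbound i : has_lbound [set t 0 i | t in [set t | co_rad (F t)]].
Proof.
set s := p 0; have zs : z s = 1 := level_above_point 0.
have [N zN] := level_bottom i s; exists (- N%:R) => _ [t /co_rad_level zt <-].
rewrite leNgt; apply/negP => tN.
have [M /(_ M (leqnn M)) hM] := box_level_total zs.
have h0 : box z (set_coord (low M) i (Num.max (low M 0 i) (- N%:R))) s = 0.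
  by apply: (@box_level_disjoint _ s t i _ zt); rewrite set_coordE eqxx le_max (ltW tN) orbT.
have h3 : z (set_coord s i (Num.min (s 0 i) (- N%:R))) <= 0.
  rewrite -zN; apply/ea_le_level/resolution_mono/le_set_coord; first by move=> j.
  by rewrite ge_min lexx orbT.
have := le_trans (box_level_le (low M) _) h3.
by have := box_split z (low M) s i (- N%:R); rewrite hM h0 addr0 => <-.
Qed.

Lemma levelP t : z t = 1 <-> strictly_below t0 t.
Proof.
split; last exact: level_above_characteristic.
move=> /level_strictly_below[s st zs] i; apply: le_lt_trans (st i).
rewrite mxE; apply: ge_inf; first exact: characteristic_lbound.
by exists s => //; exact: level_co_rad.
Qed.

Lemma level0P t : z t = 0 <-> exists i, t 0 i <= t0 0 i.
Proof.
split.
  move=> zt; apply: contrapT => /forallNP h.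
  have : z t = 1 by apply/levelP => i; rewrite ltNge; apply/negP.
  by rewrite zt.
move=> [i ti]; case: (level01 (F t)) => // /levelP/(_ i).
by rewrite ltNge ti.
Qed.

Lemma box_level1P a b : box z a b = 1 -> le_coord a t0 /\ strictly_below t0 b.
Proof.
move=> ab; have zb : strictly_below t0 b.
  apply/levelP/le_anti; rewrite level_le1 /= -ab; exact: box_level_le.
split=> // i; rewrite leNgt; apply/negP => ti.
suff : box z a b = 0 by rewrite ab.
apply: (@box_level_disjoint _ _ (set_coord b i (Num.min (b 0 i) (a 0 i))) i).
  by rewrite set_coordE eqxx ge_min lexx orbT.
apply/levelP => j; rewrite set_coordE; case: eqP => [->|_]; last exact: zb.
by rewrite lt_min zb ti.
Qed.

Lemma box_level01 a b : box z a b = 0 \/ box z a b = 1.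
Proof.
have h0 := dist_box zd a b; have h1 := le_trans (box_level_le a b) (level_le1 b).
by move: (box z a b) h0 h1 => x *; lia.
Qed.

Lemma box_above_point_approx k :
  vF (p k) - (\sum_(i <- enum 'I_n) vF (set_coord (p k) i (t0 0 i))) *+ 2 ^ size (enum 'I_n)
    <= box vF t0 (p k).
Proof.
have := @mixed_diff_approx R n _ (lexZ_po po) (enum 'I_n) t0 (p k) (p k) vF (dist_ge0 Wd)
  (dist_mono Wd) (enum_uniq _) (fun _ _ => erefl).
move=> /= /andP[+ _]; under eq_bigr do rewrite (min_idPl (ltW (above_point_gt _ _))).
by [].
Qed.

Lemma sum_fst (I : Type) (r : seq I) (H : I -> lexZ G) :
  (\sum_(i <- r) H i).1 = \sum_(i <- r) (H i).1.
Proof. by elim: r => [|i r IH]; rewrite ?big_nil// !big_cons -IH. Qed.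

Lemma mulrn_fst (x : lexZ G) k : (x *+ k).1 = x.1 *+ k.
Proof. by elim: k => [|k IH]; rewrite ?mulr0n// !mulrS -IH. Qed.

Let err k : lexZ G :=
  (\sum_(i <- enum 'I_n) vF (set_coord (p k) i (t0 0 i))) *+ 2 ^ size (enum 'I_n).

Let err_level k : (err k).1 = 0.
Proof.
rewrite mulrn_fst sum_fst big1 ?mul0rn// => i _.
by apply/level0P; exists i; rewrite set_coordE eqxx.
Qed.

Lemma box_level_above_point k : box z t0 (p k) = 1.
Proof.
apply/le_anti; rewrite (le_trans (box_level_le _ _) (level_le1 _)) /=.
rewrite -box_level; apply: le_trans (lexZ_le_fst (box_above_point_approx k)).
by rewrite /= -/(err k) err_level subr0 -/(level _) [level _]level_above_point.
Qed.

Lemma box_height_above_point_nondec : nondec (fun k => - box g t0 (p k)).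
Proof.
apply: nondec_step => k; rewrite (po_leN po) -!box_height -lexZ_le_eq.
  apply: (box_mono (lexZ_po po) (dist_box Wd)) => // i; exact: above_point_mono.
by rewrite !box_level !box_level_above_point.
Qed.

(** The boxes shrinking to the characteristic point have level [1] and decreasing heights. The
    infimum given by [sr_characteristic], minus the error term at the first point, bounds them
    below; the limit height is that of the atom. *)
Lemma atom_exists : exists u, is_lub (fun k => - box g t0 (p k)) u.
Proof.
have [m [ms _] /co_rad_level m1] := sr_characteristic Fsr.
apply: (nondec_lub sc box_height_above_point_nondec (b := - (ea_val m - err 0).2)) => k.
rewrite (po_leN po) -box_height -lexZ_le_eq; last first.
  by rewrite box_level box_level_above_point /= err_level subr0.
apply: le_trans (box_above_point_approx k); apply: (po_leD (lexZ_po po)).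
  by apply: ms; exists (p k) => //; exact: above_point_gt.
rewrite (po_leN (lexZ_po po)); apply: (po_leMn (lexZ_po po)).
apply: (po_le_sum (lexZ_po po)) => i; apply: (dist_mono Wd); apply: le_set_coord => //.
elim: k => [|k IH] j //; exact: le_trans (above_point_mono k j) (IH j).
Qed.

(** * Removal of the atom at the characteristic point *)

Section Atom.
Variable u : G.
Hypothesis u_lub : is_lub (fun k => - box g t0 (p k)) u.

(* Moving the mass [(1, - u)] of the characteristic point to [0] turns the
   resolution into a distribution function with values in [G]. *)
Definition atomless t : G := g t + u *~ z t.

Let f := atomless.

Lemma atomless_level0 t : z t = 0 -> f t = g t.
Proof. by move=> zt; rewrite /f /atomless zt mulr0z addr0. Qed.

Lemma atomless_level1 t : z t = 1 -> f t = g t + u.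
Proof. by move=> zt; rewrite /f /atomless zt mulr1z. Qed.

Lemma box_atomless a b : box f a b = box g a b + u *~ box z a b.
Proof.
rewrite /f /atomless boxD; congr (_ + _).
by rewrite /box (mixed_diff_additive (h := fun k => u *~ k))// => x y; rewrite mulrzBr.
Qed.

Lemma above_point_below b : strictly_below t0 b -> exists K, forall k, (K <= k)%N -> le_coord (p k) b.
Proof.
move=> tb; have [N hN] := nat_coord_bound (\row_i (b 0 i - t0 0 i)^-1).
exists N => k Nk i; rewrite mxE addrC -lerBrDr.
have bt : 0 < b 0 i - t0 0 i by rewrite subr_gt0.
rewrite -[leRHS]invrK lef_pV2 ?posrE ?invr_gt0//.
apply: le_trans (ler_norm _) _; have := hN i; rewrite mxE => /le_trans; apply.
by rewrite ler_nat; exact: leqW.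
Qed.

(** A box of level [0] has nonnegative height. One of level [1] contains the box from [t0] to some
    [p K], whose height is at least [- u]. *)
Lemma atomless_box_ge0 a b : 0 <= box f a b.
Proof.
have ab0 := box_resolution_ge0 a b; rewrite box_atomless.
have [ab|ab] := box_level01 a b.
  by rewrite ab mulr0z addr0 -box_height; rewrite lexZ_le_eq// box_level ab in ab0.
have [at0 tb] := box_level1P ab; have [K hK] := above_point_below tb.
have : box vF t0 (p K) <= box vF a b.
  by apply: (box_mono (lexZ_po po) (dist_box Wd)) => //; exact: hK.
rewrite lexZ_le_eq ?box_level ?box_level_above_point ?ab// !box_height => h.
rewrite ?ab mulr1z -(po_leBlDr po) sub0r (po_leNl po); apply: le_trans (u_lub.1 K).
by rewrite (po_leN po).
Qed.

(** The case of interest is the jump from level [0] to level [1], where the lexicographic order says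
    nothing about heights. *)
Lemma atomless_mono s t : le_coord s t -> f s <= f t.
Proof.
move=> st; have Fst := resolution_mono st.
case: (level01 (F t)) => zt.
  have zs : z s = 0.
    by have := ea_le_level Fst; rewrite zt /z; case: (level01 (F s)) => ->.
  by rewrite !atomless_level0// -ea_le_height ?zt.
case: (level01 (F s)) => zs.
  rewrite (atomless_level0 zs) (atomless_level1 zt).
  have [i si] := (level0P s).1 zs; have tt := (levelP t).1 zt.
  have [K hK] := above_point_below tt; have [M hM] := nat_coord_bound t0.
  have lowt N : (M <= N)%N -> le_coord (low N) t0.
    move=> MN j; rewrite mxE; apply: (@le_trans _ _ (- M%:R)); first by rewrite lerN2 ler_nat.
    by have := hM j; rewrite ler_norml => /andP[].
  have wpo := lexZ_po po; have bm := box_mono wpo (dist_box Wd).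
  (* Coordinate [i] of [s] is at most that of [t0], so a hyperplane through [t0] separates the box
     below [s] from the box at [t0]; both fit into the box below [t]. *)
  have hN N : (M <= N)%N -> box vF (low N) s <= vF t - box vF t0 (p K).
    move=> MN; rewrite (po_leBrDr wpo); apply: le_trans ((box_lub wpo t Wd).1 N).
    rewrite (box_split vF (low N) t i (t0 0 i)); apply: (po_leD wpo); apply: bm => //.
    + move=> j; rewrite set_coordE; case: eqP => [->|_]; last exact: st.
      by rewrite le_min st si.
    + by move=> j; rewrite set_coordE; case: eqP => [->|_]; rewrite ?ge_max ?lowt ?lexx.
    + exact: hK.
  have : vF s <= vF t - box vF t0 (p K).
    apply: (box_lub wpo s Wd).2 => N; apply: le_trans (hN (maxn M N) (leq_maxl _ _)).
    by apply: bm => // j; rewrite !mxE lerN2 ler_nat leq_maxr.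
  rewrite lexZ_le_eq; last first.
    by rewrite /= box_level box_level_above_point -/(level _) zs -/(level _) zt subrr.
  rewrite /= box_height -/(height _) -/(height _) => h; apply: (le_trans h).
  by rewrite (po_leDl po); exact: u_lub.1.
by rewrite !atomless_level1// (po_leDr po) -ea_le_height ?zt.
Qed.

Lemma atomless_ge0 t : 0 <= f t.
Proof.
pose s := set_coord t i0 (Num.min (t 0 i0) (t0 0 i0)).
have zs : z s = 0 by apply/level0P; exists i0; rewrite set_coordE eqxx ge_min lexx orbT.
apply: (@le_trans _ _ (f s)); first by rewrite atomless_level0//; exact: height_ge0.
by apply: atomless_mono; apply: set_coord_le; rewrite ge_min lexx.
Qed.

Lemma atomless_distribution : distribution f.
Proof.
split; [exact: atomless_box_ge0|exact: atomless_ge0|exact: atomless_mono|].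
move=> i t; have [N [zN gN]] := height_bottom i t.
apply: (@is_lub_shift _ _ _ N).
  apply: nondec_step => k; rewrite (po_leN po); apply/atomless_mono/le_set_coord => //.
  by rewrite lerN2 ler_nat.
rewrite (_ : (fun k => _) = fun k => - g (set_coord t i (- (N + k)%:R)))//.
by apply/funext => k; rewrite atomless_level0.
Qed.

Lemma level_eventually_top : exists M, forall N, (M <= N)%N -> z (cube N) = 1.
Proof.
have [M hM] := nat_coord_bound t0; exists M.+1 => N MN; apply/levelP => i.
rewrite [X in _ < X]mxE; apply: le_lt_trans (ler_norm _) _; apply: le_lt_trans (hM i) _.
by rewrite ltr_nat.
Qed.

(** The top is (1, 0), so the heights of the cubes tend to [0], and [u] is added as soon as the
    level is [1]. *)
Lemma atomless_top : is_lub (fun N => f (cube N)) u.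
Proof.
have [M zM] := level_eventually_top.
have zMk k : z (cube (M + k)) = 1 by apply: zM; rewrite leq_addr.
have cube_le N K : (N <= K)%N -> le_coord (cube N) (cube K).
  by move=> NK i; rewrite !mxE ler_nat.
have := @ea_sup_height _ sc (fun k => F (cube (M + k))) (ea1 G).
move=> /(_ _ _ _ _)[].
- by move=> k; apply/resolution_mono/cube_le; rewrite leq_add2l.
- exact: zMk.
- by move=> k; rewrite ea_leE; have /andP[] := ea_bounds (F (cube (M + k))).
- move=> e he; have [_] := sr_top Fsr; apply => _ [t _ <-].
  have [K hK] := nat_coord_bound t; apply: le_trans (he K); apply: resolution_mono => i.
  rewrite mxE; apply: le_trans (ler_norm _) _; apply: le_trans (hK i) _.
  by rewrite ler_nat leq_addl.
move=> h1 h2; apply: (@is_lub_shift _ _ _ M).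
  by move=> N K NK; apply/atomless_mono/cube_le.
rewrite (_ : (fun k => _) = fun k => g (cube (M + k)) + u); last first.
  by apply/funext => k; rewrite atomless_level1.
by rewrite -[X in is_lub _ X]add0r; apply: is_lub_addr => //; split.
Qed.

Let left_point t (k : nat) : 'rV[R]_n := \row_i (t 0 i - k.+1%:R^-1).

Lemma left_point_lt t k : strictly_below (left_point t k) t.
Proof. by move=> i; rewrite mxE ltrBlDr ltrDl invr_gt0 ltr0Sn. Qed.

Lemma left_point_mono t j k : (j <= k)%N -> le_coord (left_point t j) (left_point t k).
Proof.
by move=> jk i; rewrite !mxE lerD2l lerN2 lef_pV2 ?posrE ?ltr0Sn// ler_nat.
Qed.

Lemma left_point_above s t : strictly_below s t ->
  exists K, forall k, (K <= k)%N -> strictly_below s (left_point t k).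
Proof.
move=> st; have [N hN] := nat_coord_bound (\row_i (t 0 i - s 0 i)^-1).
exists N => k Nk i; rewrite mxE ltrBrDr -ltrBrDl.
have ts : 0 < t 0 i - s 0 i by rewrite subr_gt0.
rewrite -[ltRHS]invrK ltf_pV2 ?posrE ?invr_gt0//.
apply: le_lt_trans (ler_norm _) _; have := hN i; rewrite mxE => /le_lt_trans; apply.
by rewrite ltr_nat ltnS.
Qed.

(** Level [1] holds exactly on the open orthant above [t0], so the level is eventually constant
    along [left_point] and suprema reduce to suprema of heights. *)
Lemma atomless_left t : is_lub (fun k => f (left_point t k)) (f t).
Proof.
have [M zM] : exists M, forall k, (M <= k)%N -> z (left_point t k) = z t.
  case: (level01 (F t)) => zt.
    exists 0%N => k _; rewrite [RHS]zt; apply/level0P.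
    have [i ti] := (level0P t).1 zt; exists i; apply: le_trans ti.
    exact/ltW/left_point_lt.
  have [K hK] := left_point_above ((levelP t).1 zt); exists K => k /hK h.
  by rewrite [RHS]zt; apply/levelP.
have zMk k : z (left_point t (M + k)) = z t by apply: zM; rewrite leq_addr.
have nd : nondec (fun k => f (left_point t k)).
  by move=> j k jk; apply/atomless_mono/left_point_mono.
apply: (@is_lub_shift _ _ _ M nd).
rewrite (_ : (fun k => _) = fun k => g (left_point t (M + k)) + u *~ z t); last first.
  by apply/funext => k; rewrite /f /atomless zMk.
apply: is_lub_addr => //; apply: (ea_sup_height sc) => //.
- by move=> k; apply/resolution_mono/left_point_mono; rewrite leq_add2l.
- by move=> k; apply: resolution_mono => i; exact/ltW/left_point_lt.
- move=> e he; have [_] := sr_left_continuous Fsr t; apply => _ [s st <-].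
  have [K hK] := left_point_above st; apply: le_trans (he K); apply: resolution_mono => i.
  by apply/ltW/hK; rewrite leq_addl.
Qed.

End Atom.

End Reduction.

(** * Observables *)

Section Observables.
Variables (R : realType) (n : nat) (G : porderZmodType).
Implicit Types x y : set 'rV[R]_n -> gamma_ea G.

Lemma ea_addE (a b c : gamma_ea G) : ea_add a b = Some c -> ea_val a + ea_val b = ea_val c.
Proof. by rewrite /ea_add; case: insubP => // d _ <- [->]. Qed.

Lemma ea_add_some (a b c : gamma_ea G) : ea_val a + ea_val b = ea_val c -> ea_add a b = Some c.
Proof. by rewrite /ea_add => ->; exact: valK. Qed.

Lemma observableD x A B : observable x -> borel_Rn A -> borel_Rn B -> B `<=` A ->
  ea_val (x (A `\` B)) = ea_val (x A) - ea_val (x B).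
Proof.
move=> ox mA mB BA; have mD : borel_Rn (A `\` B) by exact: g_sigma_setD mA mB.
have := obs_additive ox mD mB; rewrite setDKI setDKU// => /(_ erefl)/ea_addE <-.
by rewrite addrK.
Qed.

Lemma observable_unique x y : observable x -> observable y ->
  (forall t, x (lower_orthant t) = y (lower_orthant t)) ->
  forall A, borel_Rn A -> x A = y A.
Proof.
move=> ox oy xy.
suff H : @borel_Rn R n `<=` [set A | borel_Rn A /\ x A = y A] by move=> A /H[].
rewrite {1}borel_Rn_orthants; apply: (lambda_system_subset (@orthants_setI R n)) => //.
- split=> //.
  + by split; [exact: g_sigma_setT|rewrite (obs_total ox) (obs_total oy)].
  + move=> A B BA [mA xyA] [mB xyB]; split; first exact: g_sigma_setD mA mB.
    by apply: val_inj; rewrite /= !observableD// xyA xyB.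
  + move=> A ndA hA; have mA k := (hA k).1.
    have ndA' k : A k `<=` A k.+1 by apply/subsetPset/ndA.
    split; first exact: g_sigma_bigcup.
    have [xub xlub] := obs_continuous ox mA ndA'; have [yub ylub] := obs_continuous oy mA ndA'.
    have E : (fun k => x (A k)) = (fun k => y (A k)) by apply/funext => k; case: (hA k).
    by apply/le_anti/andP; split; [apply: xlub; rewrite E|apply: ylub; rewrite -E].
- move=> _ [t _ <-]; split; last exact: xy.
  exact: borel_lower_orthant.
Qed.

Hypothesis po : po_group G.
Variables (kappa : set 'rV[R]_n -> G) (u : G) (t0 : 'rV[R]_n).
Hypothesis kappa_ge0 : forall A, borel_Rn A -> 0 <= kappa A.
Hypothesis kappaT : kappa setT = u.
Hypothesis kappaU : forall A B, borel_Rn A -> borel_Rn B -> A `&` B = set0 ->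
  kappa (A `|` B) = kappa A + kappa B.
Hypothesis kappa_lub : forall A : nat -> set 'rV[R]_n, (forall k, borel_Rn (A k)) ->
  (forall k, A k `<=` A k.+1) -> is_lub (fun k => kappa (A k)) (kappa (\bigcup_k A k)).

(** The sum of [kappa] and a point mass (1, - u) at [t0], which puts back the atom that [atomless]
    removes. *)
Definition atomic_value (A : set 'rV[R]_n) : lexZ G :=
  if `[< A t0 >] then lexZ_pair 1 (kappa A - u) else lexZ_pair 0 (kappa A).

Definition atomic_observable (A : set 'rV[R]_n) : gamma_ea G := insubd (ea0 G) (atomic_value A).

Lemma kappa_le A : borel_Rn A -> kappa A <= u.
Proof.
move=> mA; have mC : borel_Rn (~` A) by exact: g_sigma_setC.
have := kappaU mA mC (setICr A); rewrite setUCr kappaT => ->.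
by rewrite po_lerDl// kappa_ge0.
Qed.

Lemma atomic_observableE A : borel_Rn A -> ea_val (atomic_observable A) = atomic_value A.
Proof.
move=> mA; apply: insubdK; rewrite /atomic_value; case: asboolP => _; apply/andP; split.
- exact: lexZ_lt.
- by rewrite lexZ_le_eq//= (po_suble0 po) kappa_le.
- by rewrite lexZ_le_eq//= kappa_ge0.
- exact: lexZ_lt.
Qed.

Lemma atomic_level A : borel_Rn A -> level (atomic_observable A) = (`[< A t0 >] : nat).
Proof. by move=> mA; rewrite /level atomic_observableE// /atomic_value; case: ifP. Qed.

Lemma atomic_height A : borel_Rn A ->
  height (atomic_observable A) = kappa A - (if `[< A t0 >] then u else 0).
Proof.
by move=> mA; rewrite /height atomic_observableE// /atomic_value; case: ifP; rewrite ?subr0.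
Qed.

(** If [t0] never enters the sets, an upper bound of level [1] is automatically large enough. If it
    enters at stage [K], every upper bound has level [1], and the heights from [K] on decide. *)
Lemma atomic_observable_continuous (A : nat -> set 'rV[R]_n) :
  (forall k, borel_Rn (A k)) -> (forall k, A k `<=` A k.+1) ->
  supremums (range (fun k => atomic_observable (A k))) (atomic_observable (\bigcup_k A k)).
Proof.
move=> mA ndA; have mU : borel_Rn (\bigcup_k A k) by exact: g_sigma_bigcup.
have [kub klub] := kappa_lub mA ndA.
have levelA k : `[< A k t0 >] -> `[< (\bigcup_k A k) t0 >].
  by move=> /asboolP h; apply/asboolP; exists k.
split=> [_ [k _ <-]|e he].
  case: (boolP `[< (\bigcup_k A k) t0 >]) => hU; last first.
    have hk : `[< A k t0 >] = false by apply/negbTE; apply: contra hU; exact: levelA.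
    rewrite ea_le_height ?atomic_level// ?atomic_height// (negbTE hU) hk//.
    by rewrite !subr0.
  case: (boolP `[< A k t0 >]) => hk.
    by rewrite ea_le_height ?atomic_level// ?atomic_height// hU hk// (po_leDr po).
  by apply: ea_lt_level; rewrite atomic_level// ?hU// (negbTE hk).
have hek k : atomic_observable (A k) <= e by apply: he; exists k.
case: (boolP `[< (\bigcup_k A k) t0 >]) => hU; last first.
  have hk k : `[< A k t0 >] = false by apply/negbTE; apply: contra hU; exact: levelA.
  case: (level01 e) => le1; last by apply: ea_lt_level; rewrite ?atomic_level// (negbTE hU).
  rewrite ea_le_height ?atomic_level// ?atomic_height// (negbTE hU)// subr0.
  apply: klub => k; have := hek k.
  by rewrite ea_le_height ?atomic_level// ?atomic_height// hk// subr0.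
have /asboolP[K _ hK] := hU.
have hk k : (K <= k)%N -> `[< A k t0 >].
  move=> Kk; apply/asboolP; rewrite -(subnKC Kk); elim: (k - K)%N => [|j IH].
    by rewrite addn0.
  by rewrite addnS; exact: ndA.
have le1 : level e = 1.
  have := ea_le_level (hek K); rewrite atomic_level// hk//.
  by case: (level01 e) => ->.
rewrite ea_le_height ?atomic_level// ?atomic_height// hU ?le1// (po_leBlDr po).
apply: klub => k; apply: (@le_trans _ _ (kappa (A (maxn K k)))).
  have ndk : nondec (fun k => kappa (A k)).
    apply: nondec_step => j; have mD : borel_Rn (A j.+1 `\` A j).
      exact: (g_sigma_setD (mA j.+1) (mA j)).
    have := kappaU mD (mA j); rewrite setDKI setDKU// => /(_ erefl) ->.
    by rewrite po_lerDr// kappa_ge0.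
  by apply: ndk; rewrite leq_maxr.
have := hek (maxn K k).
by rewrite ea_le_height ?atomic_level// ?atomic_height// hk ?leq_maxl ?le1// (po_leBlDr po).
Qed.

Lemma atomic_observableP : observable atomic_observable.
Proof.
split.
- apply: val_inj; rewrite /= atomic_observableE; last exact: g_sigma_setT.
  by rewrite /atomic_value asboolT// kappaT subrr.
- move=> A B mA mB AB; have mU : borel_Rn (A `|` B) by exact: g_sigma_setU mA mB.
  apply: ea_add_some; rewrite !atomic_observableE// /atomic_value kappaU//.
  rewrite asbool_or; case: asboolP => At; case: asboolP => Bt /=.
  + by have : (A `&` B) t0 by []; rewrite AB.
  + by rewrite [RHS](_ : _ = lexZ_pair 1 (kappa A - u + kappa B))// addrAC.
  + by rewrite [RHS](_ : _ = lexZ_pair 1 (kappa A + (kappa B - u)))// addrA.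
  + by [].
- exact: atomic_observable_continuous.
Qed.

End Observables.

Theorem theorem3p5 (R : realType) (n : nat) (n_ge1 : (1 <= n)%N)
    (G : porderZmodType) (G_po : po_group G) (G_dir : directed_group G)
    (G_sigma : monotone_sigma_complete G) (G_int : interpolation G)
    (F : 'rV[R]_n -> gamma_ea G) (F_sr : spectral_resolution F) :
  exists x : set 'rV[R]_n -> gamma_ea G,
    [/\ observable x,
        extends_resolution F x
      & forall y : set 'rV[R]_n -> gamma_ea G,
          observable y -> extends_resolution F y ->
          forall A : set 'rV[R]_n, borel_Rn A -> y A = x A].
Proof.
have i0 : 'I_n := Ordinal n_ge1.
have ic := sigma_complete_integrally_closed G_po G_sigma G_int.
have [u u_lub] := atom_exists G_po G_dir G_sigma F_sr.
have [kappa [k0 kT kU kl kO]] := measure_of_distribution i0 G_po G_dir ic G_sigma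
  (atomless_distribution i0 G_po G_dir G_sigma F_sr u_lub)
  (atomless_top G_po G_dir G_sigma F_sr u_lub)
  (atomless_left G_po G_dir G_sigma F_sr u_lub).
set x := atomic_observable kappa u (characteristic_point F).
have ox : observable x by exact: atomic_observableP.
have xF : extends_resolution F x.
  move=> t; have mO : borel_Rn (lower_orthant t).
    exact: borel_lower_orthant.
  apply: val_inj; rewrite /= atomic_observableE// /atomic_value kO.
  (* By [levelP], the orthant contains the characteristic point exactly when [F t] has level [1];
     then the [u] of [atomless] cancels the [- u] of the atom. *)
  case: asboolP => h.
    have zt := (levelP G_po G_dir F_sr t).2 h.
    rewrite atomless_level1// addrK /lexZ_pair -zt /level /height.
    by case: (ea_val (F t)).
  have zt : level (F t) = 0.
    by case: (level01 (F t)) => // /(levelP G_po G_dir F_sr t).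
  rewrite atomless_level0// /lexZ_pair -zt /level /height.
  by case: (ea_val (F t)).
exists x; split=> // y oy yF A mA; apply: observable_unique mA => // t.
by rewrite yF xF.
Qed.
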